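(* Let $G=(V,E)$ be a directed graph on $n$ vertices with vertex weights $\pi:V\to\mathbb{R}_+$. Then $$\lambda^{\Delta_v}_\pi(G)\lesssim\vec\psi_\pi(G)\lesssim\sqrt{\log n}\cdot\lambda^{\Delta_v}_\pi(G).$$
   Context: For $S\subseteq V$, $\partial^+(S)=\{v\notin S:\exists u\in S,\ uv\in E\}$, $\pi(S)=\sum_{i\in S}\pi(i)$, $\vec\psi_\pi(S)=\frac{\min\{\pi(\partial^+(S)),\pi(\partial^+(\overline S))\}}{\min\{\pi(S),\pi(\overline S)\}}$ and $\vec\psi_\pi(G)=\min_{\emptyset\ne S\subsetneq V}\vec\psi_\pi(S)$. $\mathcal F_v(G)$ is the set of $F:E\to\mathbb{R}_{\ge0}$ with $\sum_{j:ij\in E}F(i,j)=\sum_{j:ji\in E}F(j,i)\le\pi(i)$ for all $i\in V$. Define $$\lambda^{\Delta_v}_\pi(G)=\min_{v_1,\dots,v_n\in\mathbb{R}^n}\max_{F\in\mathcal F_v(G)}\tfrac12\sum_{ij\in E}F(i,j)\|v_i-v_j\|^2$$ subject to $\sum_i\pi(i)v_i=0$, $\sum_i\pi(i)\|v_i\|^2=1$, and $\|v_i-v_j\|^2+\|v_j-v_k\|^2\ge\|v_i-v_k\|^2$ for all $i,j,k\in V$. $\lesssim$ hides an absolute constant. *)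

(* Defs.v *)
From HB Require Import structures.
From mathcomp Require Import all_boot all_order all_algebra.
From mathcomp Require Import all_classical all_reals all_analysis.
Set Implicit Arguments. Unset Strict Implicit. Unset Printing Implicit Defensive.
Import Order.TTheory GRing.Theory Num.Theory.
Local Open Scope ring_scope.
Local Open Scope classical_set_scope.

Section Defs.
Variable R : realType.
Variable n : nat.

Definition wt (pi : 'I_n -> R) (S : {set 'I_n}) : R := \sum_(i in S) pi i.

Definition out_bd (E : rel 'I_n) (S : {set 'I_n}) : {set 'I_n} :=
  [set v | (v \notin S) && [exists u, (u \in S) && E u v]].

Definition psi_set (E : rel 'I_n) (pi : 'I_n -> R) (S : {set 'I_n}) : R :=
  Num.min (wt pi (out_bd E S)) (wt pi (out_bd E (~: S)))
  / Num.min (wt pi S) (wt pi (~: S)).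

(* psi_pi(G) = min over nonempty proper subsets S (a finite set, so inf = min) *)
Definition psi_graph (E : rel 'I_n) (pi : 'I_n -> R) : R :=
  inf [set psi_set E pi S | S in [set S : {set 'I_n} | (S != finset.set0) && (S != [set: 'I_n]%SET)]].

Definition sqnorm (x : 'rV[R]_n) : R := \sum_(k < n) x ord0 k ^+ 2.

Definition flow_ok (E : rel 'I_n) (pi : 'I_n -> R) (F : 'I_n -> 'I_n -> R) : Prop :=
  (forall i j, E i j -> 0 <= F i j) /\
  (forall i, \sum_(j | E i j) F i j = \sum_(j | E j i) F j i) /\
  (forall i, \sum_(j | E i j) F i j <= pi i).

Definition flow_energy (E : rel 'I_n) (F : 'I_n -> 'I_n -> R)
  (v : 'I_n -> 'rV[R]_n) : R :=
  2^-1 * \sum_(i < n) \sum_(j < n | E i j) F i j * sqnorm (v i - v j).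

Definition max_flow_energy (E : rel 'I_n) (pi : 'I_n -> R) (v : 'I_n -> 'rV[R]_n) : R :=
  sup [set flow_energy E F v | F in flow_ok E pi].

Definition feasible (pi : 'I_n -> R) (v : 'I_n -> 'rV[R]_n) : Prop :=
  \sum_(i < n) pi i *: v i = 0 /\
  \sum_(i < n) pi i * sqnorm (v i) = 1 /\
  (forall i j k, sqnorm (v i - v j) + sqnorm (v j - v k) >= sqnorm (v i - v k)).

Definition lambda_dv (E : rel 'I_n) (pi : 'I_n -> R) : R :=
  inf [set max_flow_energy E pi v | v in feasible pi].

End Defs.

(* Main.v *)
(** The lower bound on [psi] evaluates the relaxation at two-valued embeddings.  For the
    other one, linear programming duality turns an embedding [v] with flow value [D] into
    vertex costs [q >= 0] of total [sum pi q <= D] and a potential [r] such that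
    [|v_i - v_j|^2 / 2 <= q_j + r_j - r_i] on edges.  Level sets of a directed distance
    to a set [A], where [A] is halved at a median of [r] so that the potential helps, show
    that [psi] is at most [D] over [pi(A) sum_j pi_j d(A, j)], up to constants.

    It remains to find [A] with [pi(A) sum_j pi_j d(A, j) >= c / sqrt (ln n)] (Arora-Rao-Vazirani).
    If some ball of constant radius has constant mass it can serve as [A].  Otherwise project
    on random signs [s].  If no [A] works, then for most [s] greedy matching pairs a constant
    mass of points which are at distance [Delta] or less but whose projections differ
    by a constant.  Let [Y_k i] be the largest increase of the projection from [i] to a point at
    distance at most [k * Delta].  Following a matching edge gains a constant, and the
    variance of [Y_k i] is [O(k * Delta)] by the Efron-Stein inequality, so that the mean of
    [Y_k] grows linearly as long as [k * Delta] is small.  A union bound makes it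
    [O(sqrt (k * Delta * ln n))], a contradiction for [Delta] of order [1 / sqrt (ln n)]. *)

Require Import Defs.
From HB Require Import structures.
From mathcomp Require Import all_boot all_order all_algebra.
From mathcomp Require Import all_classical all_reals all_analysis.
From mathcomp Require Import ring lra.
Import Order.TTheory GRing.Theory Num.Theory.
Local Open Scope ring_scope.
Set Implicit Arguments. Unset Strict Implicit. Unset Printing Implicit Defensive.

(** * Farkas' lemma *)

Section Farkas.
Variable R : realFieldType.

Lemma exists_between (I : finType) (P Q : pred I) (lo hi : I -> R) :
  (forall i j, P i -> Q j -> lo i <= hi j) ->
  exists x, (forall i, P i -> lo i <= x) /\ (forall j, Q j -> x <= hi j).
Proof.
move=> lehi; have [i0 Pi0|P0] := pickP P.
  case: (@Order.TotalTheory.arg_maxP _ R I i0 P lo Pi0) => i Pi maxi.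
  by exists (lo i); split=> [j /maxi|j /(lehi _ _ Pi)].
have [j0 Qj0|Q0] := pickP Q.
  case: (@Order.TotalTheory.arg_minP _ R I j0 Q hi Qj0) => j Qj minj.
  by exists (hi j); split=> [i|i /minj //]; rewrite P0.
by exists 0; split=> i; rewrite ?P0 ?Q0.
Qed.

(** Rows left after eliminating the variable with coefficients [c]: those with coefficient 0, and
    for each positive and negative pair the combination that cancels it. Indicators zero out all
    other indices, so the index type stays a plain sum. *)
Definition elim_row (I : finType) (c t : I -> R) (p : I + I * I) : R :=
  match p with
  | inl i => (c i == 0)%:R * t i
  | inr (i, j) => ((0 < c i) && (c j < 0))%:R * (c i * t j - c j * t i)
  end.

(** The transpose of [elim_row c]: it pulls multipliers of the reduced system back to the original
    rows. *)
Definition elim_mul (I : finType) (c : I -> R) (y : I + I * I -> R) (i : I) : R :=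
  y (inl i) * (c i == 0)%:R
  - (\sum_j y (inr (i, j)) * ((0 < c i) && (c j < 0))%:R * c j)
  + \sum_j y (inr (j, i)) * ((0 < c j) && (c i < 0))%:R * c j.

Lemma elim_mulE (I : finType) (c t : I -> R) (y : I + I * I -> R) :
  \sum_i elim_mul c y i * t i = \sum_p y p * elim_row c t p.
Proof.
rewrite big_sumType /=.
have -> : \sum_i y (inr i) * elim_row c t (inr i) =
   \sum_i \sum_j y (inr (i, j)) * elim_row c t (inr (i, j)).
  by rewrite pair_bigA; apply: eq_bigr => -[].
have -> : \sum_i elim_mul c y i * t i =
   \sum_i y (inl i) * elim_row c t (inl i) +
   ((- \sum_i \sum_j y (inr (i, j)) * ((0 < c i) && (c j < 0))%:R * c j * t i)
   + \sum_i \sum_j y (inr (j, i)) * ((0 < c j) && (c i < 0))%:R * c j * t i).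
  rewrite -sumrN -!big_split /=; apply: eq_bigr => i _.
  rewrite -!mulr_suml /elim_mul; ring.
congr (_ + _); rewrite [X in _ + X]exchange_big /= -sumrN -big_split /=.
apply: eq_bigr => i _; rewrite -sumrN -big_split /=; apply: eq_bigr => j _.
ring.
Qed.

Lemma elim_mul_ge0 (I : finType) (c : I -> R) (y : I + I * I -> R) :
  (forall p, 0 <= y p) -> forall i, 0 <= elim_mul c y i.
Proof.
move=> y0 i; rewrite /elim_mul -sumrN; apply: addr_ge0; first apply: addr_ge0.
- by rewrite mulr_ge0.
- apply: sumr_ge0 => j _; case: andP => [[_ cj]|_]; last by rewrite mulr0 mul0r oppr0.
  by rewrite mulr1 -mulrN mulr_ge0// oppr_ge0 ltW.
- apply: sumr_ge0 => j _; case: andP => [[cj _]|_]; last by rewrite mulr0 mul0r.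
  by rewrite mulr1 mulr_ge0// ltW.
Qed.

(* Fourier-Motzkin elimination of the last variable. *)
Lemma farkas (k : nat) (I : finType) (a : I -> nat -> R) (b : I -> R) :
  (forall x : nat -> R, exists i, b i < \sum_(l < k) a i l * x l) ->
  exists y : I -> R, [/\ forall i, 0 <= y i,
    forall l, (l < k)%N -> \sum_i y i * a i l = 0 & \sum_i y i * b i < 0].
Proof.
elim: k I a b => [|k IH] I a b infeas.
  have [i] := infeas (fun=> 0); rewrite big_ord0 => bi.
  exists (fun j => (j == i)%:R); split=> //.
  by rewrite (bigD1 i)//= eqxx mul1r big1 ?addr0// => j /negPf->; rewrite mul0r.
pose c i := a i k.
case: (IH _ (fun p l => elim_row c (a^~ l) p) (elim_row c b)) => [x|y [y0 ya yb]].
  apply: contrapT => /forallNP feas.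
  pose s i := \sum_(l < k) a i l * x l - b i.
  have rowE p : \sum_(l < k) elim_row c (a^~ l) p * x l - elim_row c b p = elim_row c s p.
    case: p => [i|[i j]] /=; rewrite /s.
      rewrite mulrBr mulr_sumr; congr (_ - _); apply: eq_bigr => l _; ring.
    have -> : \sum_(l < k) ((0 < c i) && (c j < 0))%:R * (c i * a j l - c j * a i l) * x l
      = ((0 < c i) && (c j < 0))%:R *
        (c i * (\sum_(l < k) a j l * x l) - c j * (\sum_(l < k) a i l * x l)).
      rewrite [c i * _]mulr_sumr [c j * _]mulr_sumr -sumrB mulr_sumr.
      by apply: eq_bigr => l _; ring.
    by ring.
  have {rowE feas}sle p : elim_row c s p <= 0.
    by rewrite -rowE subr_le0 leNgt; apply/negP/feas.
  (* Row [i] asks for [c i * x0 + s i <= 0]: a lower bound on [x0] if [c i < 0], an upper bound if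
     [0 < c i]. The combined rows say that these bounds are compatible. *)
  case: (@exists_between I [pred i | c i < 0] [pred i | 0 < c i]
    (fun i => - s i / c i) (fun i => - s i / c i)) => [j i /= cj ci|x0 [lo hi]].
    have := sle (inr (i, j)); rewrite /= ci cj mul1r subr_le0 => h.
    have -> : - s j / c j = s j / - c j by rewrite invrN mulrN mulNr.
    rewrite ler_pdivrMr ?oppr_gt0// mulrAC ler_pdivlMr// mulrNN.
    by rewrite mulrC (mulrC (s i)).
  have [i] := infeas (fun l => if l == k then x0 else x l).
  rewrite big_ord_recr /= eqxx.
  have -> : \sum_(l < k) a i l * (if (l : nat) == k then x0 else x l) = s i + b i.
    by rewrite subrK; apply: eq_bigr => l _; rewrite ltn_eqF.
  rewrite addrAC ltrDr ltNge => /negP; apply.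
  case: (ltgtP (c i) 0) => ci.
  - have := lo i ci; rewrite ler_ndivrMr// /c; lra.
  - have := hi i ci; rewrite ler_pdivlMr// /c; lra.
  - by have := sle (inl i); rewrite /= ci eqxx mul1r -/(c i) ci mul0r addr0.
exists (elim_mul c y); split.
- exact: elim_mul_ge0.
- move=> l; rewrite ltnS leq_eqVlt => /orP[/eqP->|/ya]; last by rewrite (elim_mulE c (a^~ l)).
  rewrite (elim_mulE c c) big1// => -[i|[i j]] _ /=.
    by case: eqVneq => [->|]; rewrite ?mulr0 ?mul0r ?mulr0.
  by rewrite (mulrC (c j)) subrr !mulr0.
- by rewrite elim_mulE.
Qed.
End Farkas.

(** * Random signs *)

Section Signs.
Variable R : realType.
Implicit Types (f g : seq bool -> R) (u : nat -> R) (s : seq bool) (m : nat).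

(* The uniform average over [{-1, 1}^m], a sign vector being a list of [m] booleans. *)
Fixpoint mean m f : R :=
  if m is m'.+1 then
    (mean m' (fun s => f (true :: s)) + mean m' (fun s => f (false :: s))) / 2
  else f [::].

Definition sgb (b : bool) : R := if b then 1 else -1.

Fixpoint dot u s : R :=
  if s is b :: s' then u 0%N * sgb b + dot (fun k => u k.+1) s' else 0.

Definition nrm m u : R := \sum_(k < m) u k ^+ 2.

Lemma nrmS m u : nrm m.+1 u = u 0%N ^+ 2 + nrm m (fun k => u k.+1).
Proof. by rewrite /nrm big_ord_recl. Qed.

Lemma nrm_ge0 m u : 0 <= nrm m u.
Proof. by apply: sumr_ge0 => k _; exact: sqr_ge0. Qed.

Lemma mean_le m f g : (forall s, f s <= g s) -> mean m f <= mean m g.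
Proof.
elim: m f g => [|m IH] f g fg /=; first exact: fg.
by rewrite ler_pM2r ?invr_gt0 ?ltr0n// lerD//; apply: IH => s; exact: fg.
Qed.

Lemma eq_mean m f g : f =1 g -> mean m f = mean m g.
Proof. by move=> fg; apply: le_anti; rewrite !mean_le// => s; rewrite fg. Qed.

Lemma meanD m f g : mean m (fun s => f s + g s) = mean m f + mean m g.
Proof. by elim: m f g => [|m IH] f g //=; rewrite !IH; field. Qed.

Lemma meanZ m c f : mean m (fun s => c * f s) = c * mean m f.
Proof. by elim: m f => [|m IH] f //=; rewrite !IH; field. Qed.

Lemma mean_cst m c : mean m (fun=> c) = c.
Proof. by elim: m => [|m IH] //=; rewrite !IH; field. Qed.

Lemma meanB m f g : mean m (fun s => f s - g s) = mean m f - mean m g.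
Proof.
rewrite meanD; congr (_ + _); rewrite -mulN1r -meanZ.
by apply: eq_mean => s; rewrite mulN1r.
Qed.

Lemma mean_sum (I : Type) (r : seq I) (P : pred I) m (f : I -> seq bool -> R) :
  mean m (fun s => \sum_(i <- r | P i) f i s) = \sum_(i <- r | P i) mean m (f i).
Proof.
elim: r => [|i r IH].
  by rewrite big_nil -[RHS](mean_cst m); apply: eq_mean => s; rewrite big_nil.
rewrite big_cons; case: ifP => Pi; rewrite -IH -?meanD; apply: eq_mean => s;
  by rewrite big_cons Pi.
Qed.

Lemma mean_negb m f : mean m (fun s => f (map negb s)) = mean m f.
Proof.
by elim: m f => [|m IH] f //=; rewrite (IH (fun s => f (false :: s)))
  (IH (fun s => f (true :: s))) addrC.
Qed.

Lemma mean_sqr_le m f : mean m f ^+ 2 <= mean m (fun s => f s ^+ 2).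
Proof.
have : 0 <= mean m (fun s => (f s - mean m f) ^+ 2).
  by rewrite -(mean_cst m 0); apply: mean_le => s; exact: sqr_ge0.
have -> : mean m (fun s => (f s - mean m f) ^+ 2) =
  mean m (fun s => f s ^+ 2 + (- (2 * mean m f) * f s + mean m f ^+ 2)).
  by apply: eq_mean => s; ring.
rewrite !meanD meanZ mean_cst; lra.
Qed.

Lemma dotB u w s : dot (fun k => u k - w k) s = dot u s - dot w s.
Proof.
by elim: s u w => [|b s IH] u w /=; rewrite ?subr0// (IH (fun k => u k.+1) (fun k => w k.+1)); ring.
Qed.

Lemma dotZ c u s : dot (fun k => c * u k) s = c * dot u s.
Proof.
by elim: s u => [|b s IH] u /=; rewrite ?mulr0// (IH (fun k => u k.+1)); ring.
Qed.

Lemma dot0 u s : u =1 (fun=> 0) -> dot u s = 0.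
Proof. by elim: s u => [|b s IH] u u0 //=; rewrite u0 mul0r add0r IH. Qed.

Lemma dot_sum (I : Type) (r : seq I) (u : I -> nat -> R) s :
  dot (fun k => \sum_(i <- r) u i k) s = \sum_(i <- r) dot (u i) s.
Proof.
elim: s u => [|b s IH] u /=; first by rewrite big1.
by rewrite (IH (fun i k => u i k.+1)) mulr_suml -big_split.
Qed.

Lemma dot_negb u s : dot u (map negb s) = - dot u s.
Proof.
elim: s u => [|b s IH] u /=; rewrite ?oppr0// IH.
by case: b; rewrite /sgb /=; ring.
Qed.

(** The offset [c] drives the induction: once the first sign is fixed, its term joins the offset. *)
Lemma mean_dot_sqr m c u : mean m (fun s => (c + dot u s) ^+ 2) = c ^+ 2 + nrm m u.
Proof.
elim: m c u => [|m IH] c u /=; first by rewrite /nrm big_ord0 !addr0.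
under eq_mean do rewrite addrA.
under [X in _ + X]eq_mean do rewrite addrA.
by rewrite !IH nrmS /sgb; field.
Qed.

Lemma mean_dot_pow4 m c u :
  mean m (fun s => (c + dot u s) ^+ 4) <=
  c ^+ 4 + 6 * c ^+ 2 * nrm m u + 3 * nrm m u ^+ 2.
Proof.
elim: m c u => [|m IH] c u /=.
  by rewrite /nrm big_ord0 addr0 expr0n/= !mulr0 !addr0.
under eq_mean do rewrite addrA.
under [X in _ + X]eq_mean do rewrite addrA.
have h1 := IH (c + u 0%N * sgb true) (fun k => u k.+1).
have h2 := IH (c + u 0%N * sgb false) (fun k => u k.+1).
rewrite ler_pdivrMr//; apply: (le_trans (lerD h1 h2)).
rewrite nrmS /sgb; set V := nrm _ _; set a := u 0%N.
have : 0 <= a ^+ 4 by rewrite (exprM a 2 2) sqr_ge0.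
move=> a4; rewrite -subr_ge0.
have -> : (c ^+ 4 + 6 * c ^+ 2 * (a ^+ 2 + V) + 3 * (a ^+ 2 + V) ^+ 2) * 2 -
  ((c + a * 1) ^+ 4 + 6 * (c + a * 1) ^+ 2 * V + 3 * V ^+ 2 +
   ((c + a * -1) ^+ 4 + 6 * (c + a * -1) ^+ 2 * V + 3 * V ^+ 2)) = 4 * a ^+ 4 by ring.
by rewrite mulr_ge0.
Qed.

(** A Khintchine inequality, from a quartic minorant of the absolute value. With second moment
    [r ^+ 2] and fourth moment at most [3 * r ^+ 4] it leaves [5 / 9 * r], more than [r / 2]. *)
Lemma mean_abs_dot m u : Num.sqrt (nrm m u) / 2 <= mean m (fun s => `|dot u s|).
Proof.
set V := nrm m u; have V0 : 0 <= V := nrm_ge0 m u.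
have [->|Vn0] := eqVneq V 0.
  rewrite sqrtr0 mul0r -(mean_cst m 0); apply: mean_le => s; exact: normr_ge0.
set r := Num.sqrt V.
have r0 : 0 < r by rewrite sqrtr_gt0 lt_neqAle eq_sym Vn0.
have rV : r ^+ 2 = V by rewrite sqr_sqrtr.
have m2 : mean m (fun s => dot u s ^+ 2) = V.
  by have := mean_dot_sqr m 0 u; rewrite expr0n add0r /V => <-; apply: eq_mean => s; rewrite add0r.
have m4 : mean m (fun s => dot u s ^+ 4) <= 3 * V ^+ 2.
  have := mean_dot_pow4 m 0 u; rewrite !expr0n/= mulr0 mul0r !add0r => h.
  by apply: le_trans h; apply: mean_le => s; rewrite add0r.
(* |y| >= y^2 - (4/27) y^4 *)
have key s : r^-1 * dot u s ^+ 2 + (- (4 / 27 * r^-1 ^+ 3)) * dot u s ^+ 4 <= `|dot u s|.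
  set x := dot u s; set y := `|x| / r.
  have xE : `|x| = r * y by rewrite /y mulrCA divff ?mulr1// gt_eqF.
  have y0 : 0 <= y by rewrite divr_ge0// ltW.
  have -> : x ^+ 2 = (r * y) ^+ 2 by rewrite -xE real_normK ?num_real.
  have -> : x ^+ 4 = (r * y) ^+ 4.
    by rewrite -xE (exprM x 2 2) (exprM `|x| 2 2) real_normK ?num_real.
  rewrite xE -subr_ge0.
  have -> : r * y - (r^-1 * (r * y) ^+ 2 + - (4 / 27 * r^-1 ^+ 3) * (r * y) ^+ 4) =
     r * y * ((1 - 2 / 3 * y) ^+ 2 * (1 + y / 3)) by field; rewrite gt_eqF.
  apply: mulr_ge0; first by rewrite mulr_ge0 // ltW.
  by rewrite mulr_ge0 ?sqr_ge0// addr_ge0// divr_ge0.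
apply: le_trans (mean_le m key); rewrite meanD !meanZ m2 -rV.
have h : 4 / 27 * r^-1 ^+ 3 * mean m (fun s => dot u s ^+ 4) <= 4 / 27 * r^-1 ^+ 3 * (3 * (r ^+ 2) ^+ 2).
  by rewrite rV ler_wpM2l // mulr_ge0// exprn_ge0 // invr_ge0 ltW.
rewrite mulNr; apply: le_trans (lerB (lexx _) h); rewrite -subr_ge0.
have -> : r^-1 * r ^+ 2 - 4 / 27 * r^-1 ^+ 3 * (3 * (r ^+ 2) ^+ 2) - r / 2 = r / 18.
  by field; rewrite gt_eqF.
by rewrite divr_ge0 // ltW.
Qed.

(* From [1 - y <= exp (- y)], hence [exp y <= 1 / (1 - y)], at [y = x] and [y = - x]. *)
Lemma cosh_le (x : R) : (expR x + expR (- x)) / 2 <= expR (2 * x ^+ 2).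
Proof.
have [x2|x2] := leP (x ^+ 2) 2^-1; last first.
  have le_abs : expR x <= expR `|x| /\ expR (- x) <= expR `|x|.
    by rewrite !ler_expR ler_norm -normrN ler_norm.
  have : expR `|x| <= expR (2 * x ^+ 2).
    rewrite ler_expR -(real_normK (num_real x)).
    by move: x2; rewrite -(real_normK (num_real x)); have := normr_ge0 x; nra.
  by lra.
have inv_le (y : R) : y ^+ 2 <= 2^-1 -> expR y <= (1 - y)^-1.
  move=> y2; have y1 : 0 < 1 - y by nra.
  rewrite -[y in expR y]opprK expRN lef_pV2 ?posrE ?expR_gt0//.
  exact: expR_ge1Dx.
have h1 := inv_le _ x2; have h2 : expR (- x) <= (1 + x)^-1.
  by rewrite -[x in (1 + x)^-1]opprK; apply: inv_le; rewrite sqrrN.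
apply: (@le_trans _ _ (1 + 2 * x ^+ 2)); last exact: expR_ge1Dx.
apply: (@le_trans _ _ (1 - x ^+ 2)^-1); last first.
  have p : 0 < 1 - x ^+ 2 by lra.
  rewrite -div1r ler_pdivrMr//; have := sqr_ge0 x; nra.
have : (1 - x ^+ 2)^-1 = ((1 - x)^-1 + (1 + x)^-1) / 2.
  have px : 0 < 1 - x by nra.
  have qx : 0 < 1 + x by nra.
  have p : 0 < 1 - x ^+ 2 by lra.
  by field; rewrite !gt_eqF.
by lra.
Qed.

Lemma mean_expR_dot m c u :
  mean m (fun s => expR (c + dot u s)) <= expR (c + 2 * nrm m u).
Proof.
elim: m c u => [|m IH] c u /=; first by rewrite /nrm big_ord0 mulr0.
under eq_mean do rewrite addrA.
under [X in _ + X]eq_mean do rewrite addrA.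
have h1 := IH (c + u 0%N * sgb true) (fun k => u k.+1).
have h2 := IH (c + u 0%N * sgb false) (fun k => u k.+1).
rewrite ler_pdivrMr//; apply: (le_trans (lerD h1 h2)).
rewrite nrmS /sgb mulr1 mulrN1 (mulrDr 2 (u 0%N ^+ 2)) !expRD.
have := cosh_le (u 0%N); rewrite ler_pdivrMr// => h.
have p : 0 <= expR c * expR (2 * nrm m (fun k => u k.+1)) by rewrite mulr_ge0 ?expR_ge0.
have := ler_wpM2l p h.
set e1 := expR c; set e2 := expR (u 0%N); set e3 := expR (- _); set e4 := expR (2 * nrm _ _).
set e5 := expR (2 * _); lra.
Qed.

(** Jensen's inequality, from the tangent of the exponential at the mean. *)
Lemma expR_mean_le m f : expR (mean m f) <= mean m (fun s => expR (f s)).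
Proof.
set a := mean m f.
apply: (@le_trans _ _ (mean m (fun s => expR a * (1 - a + f s)))).
  by rewrite meanZ meanD mean_cst -/a subrK mulr1.
apply: mean_le => s.
have -> : f s = a + (f s - a) by rewrite addrC subrK.
rewrite expRD ler_wpM2l ?expR_ge0//.
by apply: le_trans (expR_ge1Dx _); lra.
Qed.

(** The union bound: whichever [dot (u j) s] is selected, its exponential is at most the sum of all
    of them. [lam] stays free for the caller to optimise. *)
Lemma mean_max_dot_le (J : finType) (P : pred J) (u : J -> nat -> R) m f (V lam : R) :
  0 < lam -> (forall j, P j -> nrm m (u j) <= V) ->
  (forall s, exists2 j, P j & f s = dot (u j) s) ->
  lam * mean m f <= ln #|J|%:R + 2 * lam ^+ 2 * V.
Proof.
move=> lam0 uV fE.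
have J0 : (0 < #|J|)%N by have [j _ _] := fE [::]; apply/card_gt0P; exists j.
rewrite -ler_expR expRD lnK ?posrE ?ltr0n// -meanZ.
apply: le_trans (expR_mean_le _ _) _.
apply: (@le_trans _ _ (mean m (fun s => \sum_(j | P j) expR (0 + dot (fun k => lam * u j k) s)))).
  apply: mean_le => s; have [j Pj ->] := fE s.
  rewrite (bigD1 j)//= add0r dotZ lerDl.
  by apply: sumr_ge0 => i _; exact: expR_ge0.
rewrite mean_sum; apply: (@le_trans _ _ (\sum_(j : J) expR (2 * lam ^+ 2 * V))).
  rewrite big_mkcond; apply: ler_sum => j _; case: ifP => Pj; last exact: expR_ge0.
  apply: le_trans (mean_expR_dot _ _ _) _; rewrite ler_expR add0r -mulrA ler_pM2l//.
  rewrite /nrm; under eq_bigr do rewrite exprMn.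
  by rewrite -mulr_sumr ler_wpM2l ?sqr_ge0//; exact: uV.
by rewrite sumr_const -[X in X <= _]mulr_natl.
Qed.

(** Only drops of [f] under a flip count: for a maximum of linear functions, the maximiser at [s]
    bounds the drops but not the rises. *)
Fixpoint posgrad m f s : R :=
  match m, s with
  | m'.+1, b :: s' => posgrad m' (fun s => f (b :: s)) s'
      + Num.max 0 (f (b :: s') - f (~~ b :: s')) ^+ 2
  | _, _ => 0
  end.

(** Conditioning on the first sign splits the variance into the mean conditional variance and a
    quarter of the squared difference of the conditional means. Jensen bounds the latter, and the
    drops in the two directions recombine to the full squared difference. *)
Lemma efron_stein m f :
  mean m (fun s => (f s - mean m f) ^+ 2) <= mean m (posgrad m f) / 2.
Proof.
have varE k h : mean k (fun s => (h s - mean k h) ^+ 2) = mean k (fun s => h s ^+ 2) - mean k h ^+ 2.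
  transitivity (mean k (fun s => h s ^+ 2 + (- (2 * mean k h) * h s + mean k h ^+ 2))).
    by apply: eq_mean => s; ring.
  by rewrite !meanD meanZ mean_cst; ring.
elim: m f => [|m IH] f; first by rewrite /= subrr expr0n mul0r.
rewrite varE /=.
set ft := fun s => f (true :: s); set ff := fun s => f (false :: s).
have ht := IH ft; have hf := IH ff; rewrite !varE in ht hf.
rewrite !meanD.
have hd := mean_sqr_le m (fun s => ft s - ff s).
have posE : mean m (fun s => Num.max 0 (f (true :: s) - f (false :: s)) ^+ 2) +
    mean m (fun s => Num.max 0 (f (false :: s) - f (true :: s)) ^+ 2) =
    mean m (fun s => (ft s - ff s) ^+ 2).
  rewrite -meanD; apply: eq_mean => s; rewrite -/(ft s) -/(ff s).
  by case: (ltP 0 (ft s - ff s)) => h1; case: (ltP 0 (ff s - ft s)) => h2; try lra; nra.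
rewrite meanB in hd.
move: ht hf hd posE; rewrite -/ft -/ff; lra.
Qed.

(** The affine minorant touches [f] at [s], so flipping sign [k] lowers [f] by at most twice the
    absolute value of [u k]. *)
Lemma posgrad_le m f s c u :
  (forall s', c + dot u s' <= f s') -> f s = c + dot u s ->
  posgrad m f s <= 4 * nrm m u.
Proof.
elim: m f s c u => [|m IH] f [|b s] c u hle heq /=; rewrite ?mulr_ge0 ?nrm_ge0//.
rewrite nrmS mulrDr addrC lerD//.
  have := hle (~~ b :: s); rewrite heq /=.
  set D := dot _ s; set y := f _ => h.
  have abs1 : sgb (~~ b) = - sgb b /\ sgb b ^+ 2 = 1 by case: (b); rewrite /sgb /=; split; ring.
  move: h; case: abs1 => -> sb2 h.
  have : c + (u 0%N * sgb b + D) - y <= 2 * (u 0%N * sgb b) by lra.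
  have -> : u 0%N ^+ 2 = (u 0%N * sgb b) ^+ 2 by rewrite exprMn sb2 mulr1.
  move: (u 0%N * sgb b) => t; move: (c + _ - y) => z zt.
  by case: (ltP 0 z) => hp; have := sqr_ge0 t; nra.
apply: (IH _ _ (c + u 0%N * sgb b)); last by rewrite heq addrA.
by move=> s'; rewrite -addrA; exact: (hle (b :: s')).
Qed.

(** The bound does not depend on how many linear functions compete for the maximum. *)
Lemma var_max_dot_le m f V :
  (forall s, exists u, [/\ nrm m u <= V, f s = dot u s & forall s', dot u s' <= f s']) ->
  mean m (fun s => (f s - mean m f) ^+ 2) <= 2 * V.
Proof.
move=> fE; apply: le_trans (efron_stein _ _) _.
rewrite ler_pdivrMr//; rewrite -(mean_cst m (2 * V * 2)); apply: mean_le => s.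
have [u [uV fs fle]] := fE s.
apply: le_trans (@posgrad_le m f s 0 u _ _) _.
- by move=> s'; rewrite add0r.
- by rewrite add0r.
- by lra.
Qed.

End Signs.

(** * Matchings and chaining *)

(** Go through the pairs once and raise each eligible one until an endpoint is saturated. Later
    increases respect the capacities, so saturated points stay saturated. *)
Lemma greedy_matching (R : realFieldType) (I : finType) (w : I -> R) (e : rel I) :
  (forall i, 0 <= w i) ->
  exists M : I -> I -> R, [/\ forall i j, 0 <= M i j,
    forall i j, ~~ e i j -> M i j = 0,
    forall i, \sum_j M i j <= w i, forall j, \sum_i M i j <= w j &
    forall i j, e i j -> \sum_j' M i j' = w i \/ \sum_i' M i' j = w j].
Proof.
move=> w0.
suff main (ps : seq (I * I)) : exists M : I -> I -> R, [/\ forall i j, 0 <= M i j,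
    forall i j, ~~ e i j -> M i j = 0,
    forall i, \sum_j M i j <= w i, forall j, \sum_i M i j <= w j &
    forall i j, (i, j) \in ps -> e i j ->
      \sum_j' M i j' = w i \/ \sum_i' M i' j = w j].
  case: (main (enum {: I * I})) => M [M0 Me Mr Mc sat].
  by exists M; split=> // i j; apply: sat; rewrite mem_enum.
elim: ps => [|[i0 j0] ps [M [M0 Me Mr Mc sat]]].
  by exists (fun _ _ => 0); split=> // i; rewrite big1.
case: (boolP (e i0 j0)) => [e0|ne0]; last first.
  exists M; split=> // i j; rewrite inE => /orP[/eqP[-> ->]|]; last exact: sat.
  by rewrite (negbTE ne0).
pose t := Num.min (w i0 - \sum_j M i0 j) (w j0 - \sum_i M i j0).
have t0 : 0 <= t by rewrite le_min !subr_ge0 Mr Mc.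
pose N i j := M i j + t * ((i == i0) && (j == j0))%:R.
have rowN i : \sum_j N i j = \sum_j M i j + t * (i == i0)%:R.
  rewrite big_split -mulr_sumr /=; congr (_ + t * _).
  rewrite (bigD1 j0)//= eqxx andbT big1 ?addr0// => j /negPf->.
  by rewrite andbF.
have colN j : \sum_i N i j = \sum_i M i j + t * (j == j0)%:R.
  rewrite big_split -mulr_sumr /=; congr (_ + t * _).
  by rewrite (bigD1 i0)//= eqxx /= big1 ?addr0// => i /negPf->.
have rowN_le i : \sum_j N i j <= w i.
  rewrite rowN; case: eqVneq => [->|_]; last by rewrite mulr0 addr0.
  by rewrite mulr1 -lerBrDl ge_min lexx.
have colN_le j : \sum_i N i j <= w j.
  rewrite colN; case: eqVneq => [->|_]; last by rewrite mulr0 addr0.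
  by rewrite mulr1 -lerBrDl ge_min lexx orbT.
exists N; split=> //.
- by move=> i j; rewrite addr_ge0// mulr_ge0.
- move=> i j nij; rewrite /N Me// add0r; case: andP => [[/eqP ii /eqP jj]|_]; last by rewrite mulr0.
  by move: nij; rewrite ii jj e0.
- move=> i j; rewrite inE => /orP[/eqP[-> ->] _|/sat h /h{h} [h|h]].
  + rewrite rowN colN !eqxx !mulr1 /t.
    by case: leP => _; [left|right]; rewrite addrC subrK.
  + by left; apply/le_anti; rewrite rowN_le -{1}h rowN lerDl mulr_ge0.
  + by right; apply/le_anti; rewrite colN_le -{1}h colN lerDl mulr_ge0.
Qed.

Section Chaining.
Variables (R : realType) (I : finType) (m : nat) (v : I -> nat -> R) (w : I -> R).

Definition sqdist (i j : I) : R := nrm m (fun k => v i k - v j k).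

Hypothesis w0 : forall i, 0 <= w i.
Hypothesis w1 : \sum_i w i = 1.
Hypothesis tri : forall i j k, sqdist i k <= sqdist i j + sqdist j k.

Lemma sqdist_xx i : sqdist i i = 0.
Proof. by rewrite /sqdist /nrm big1// => k _; rewrite subrr expr0n. Qed.

Lemma sqdistC i j : sqdist i j = sqdist j i.
Proof. by apply: eq_bigr => k _; rewrite -sqrrN opprB. Qed.

(** A weight in [[0, a]] has small covariance with a quantity of small variance, since [a * z <= a *
    tau / 2 + a * z ^+ 2 / (2 * tau)] at the deviation [z]. *)
Lemma mean_cov_le (l Y : seq bool -> R) (a tau : R) :
  0 < tau -> 0 <= a -> (forall s, 0 <= l s <= a) ->
  mean m (fun s => (Y s - mean m Y) ^+ 2) <= tau ^+ 2 ->
  `|mean m (fun s => l s * Y s) - mean m l * mean m Y| <= a * tau.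
Proof.
move=> tau0 a0 la var; set y := mean m Y.
have -> : mean m (fun s => l s * Y s) - mean m l * y = mean m (fun s => l s * (Y s - y)).
  rewrite (mulrC (mean m l)) -meanZ -meanB.
  by apply: eq_mean => s; ring.
have amgm s : `|l s * (Y s - y)| <= a * (tau / 2) + a / (2 * tau) * (Y s - y) ^+ 2.
  have /andP[l0 le_la] := la s.
  rewrite normrM (ger0_norm l0) -[(Y s - y) ^+ 2]real_normK ?num_real//.
  set z := `|_|; have z0 : 0 <= z := normr_ge0 _.
  apply: (@le_trans _ _ (a * z)); first by rewrite ler_wpM2r.
  rewrite -subr_ge0.
  have -> : a * (tau / 2) + a / (2 * tau) * z ^+ 2 - a * z = a * (z - tau) ^+ 2 / (2 * tau).
    by field; rewrite gt_eqF.
  by apply: divr_ge0; [rewrite mulr_ge0// sqr_ge0|rewrite mulr_ge0// ltW].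
have bound : mean m (fun s => a * (tau / 2) + a / (2 * tau) * (Y s - y) ^+ 2) <= a * tau.
  rewrite meanD mean_cst meanZ.
  have p : 0 <= a / (2 * tau) by rewrite divr_ge0// mulr_ge0// ltW.
  have := ler_wpM2l p var; rewrite -/y.
  have -> : a / (2 * tau) * tau ^+ 2 = a * (tau / 2) by field; rewrite gt_eqF.
  by lra.
rewrite ler_norml; apply/andP; split.
  rewrite lerNl -mulN1r -meanZ; apply: le_trans bound; apply: mean_le => s.
  by rewrite mulN1r; apply: le_trans (amgm s); rewrite -normrN ler_norm.
by apply: le_trans bound; apply: mean_le => s; apply: le_trans (amgm s); exact: ler_norm.
Qed.

Variable Delta : R.
Hypothesis Delta0 : 0 <= Delta.

Definition reach (k : nat) (i j : I) : bool := sqdist i j <= k%:R * Delta.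

Lemma reach_refl k i : reach k i i.
Proof. by rewrite /reach sqdist_xx mulr_ge0. Qed.

(** This is [Y_k i]. The points of a metric ball compete, rather than the ends of matching paths, so
    each maximum ranges over a set independent of the signs. *)
Definition gain (k : nat) (i : I) (s : seq bool) : R :=
  dot (v [arg max_(j > i | reach k i j) dot (v j) s]%O) s - dot (v i) s.

Lemma gain_max k i s : exists2 j, reach k i j &
  gain k i s = dot (fun l => v j l - v i l) s.
Proof.
rewrite /gain; case: arg_maxP; first exact: reach_refl.
by move=> j ij _; exists j; rewrite ?dotB.
Qed.

Lemma gain_ge k i j s : reach k i j -> dot (v j) s - dot (v i) s <= gain k i s.
Proof.
move=> ij; rewrite lerB// /gain; case: arg_maxP; first exact: reach_refl.
by move=> j' _; apply.
Qed.

Lemma gain_step k i j s : sqdist i j <= Delta ->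
  dot (v j) s - dot (v i) s + gain k j s <= gain k.+1 i s.
Proof.
move=> ij; have [j' jj' ->] := gain_max k j s; rewrite dotB.
have /(gain_ge s) : reach k.+1 i j'.
  by rewrite /reach -natr1 mulrDl mul1r addrC; apply: le_trans (tri _ j _) _; rewrite lerD.
by lra.
Qed.

Lemma gain_var k i :
  mean m (fun s => (gain k i s - mean m (gain k i)) ^+ 2) <= 2 * (k%:R * Delta).
Proof.
apply: var_max_dot_le => s; have [j ij ->] := gain_max k i s.
exists (fun l => v j l - v i l); split=> //.
- by rewrite -/(sqdist j i) sqdistC.
- by move=> s'; rewrite dotB; exact: gain_ge.
Qed.

Lemma gain_mean_le k i lam : 0 < lam ->
  lam * mean m (gain k i) <= ln #|I|%:R + 2 * lam ^+ 2 * (k%:R * Delta).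
Proof.
move=> lam0; apply: (@mean_max_dot_le _ _ (reach k i) (fun j l => v j l - v i l)) => //.
- by move=> j; rewrite -/(sqdist j i) sqdistC.
- by move=> s; exact: gain_max.
Qed.

Variable M : seq bool -> I -> I -> R.
Variables (g delta : R) (K : nat).
Hypothesis g0 : 0 < g.
Hypothesis delta0 : 0 < delta.
Hypothesis M0 : forall s i j, 0 <= M s i j.
Hypothesis Msupp : forall s i j, M s i j != 0 ->
  g <= dot (v j) s - dot (v i) s /\ sqdist i j <= Delta.
Hypothesis Mrow : forall s i, \sum_j M s i j <= w i.
Hypothesis Mcol : forall s j, \sum_i M s i j <= w j.
Hypothesis Msym : forall s i j, M (map negb s) i j = M s j i.
Hypothesis Mmass : delta <= mean m (fun s => \sum_i \sum_j M s i j).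

(** A step gains [g * delta = 4 * tau] on average. Decoupling weights from gains costs [tau] at
    either end of the edges, which leaves [2 * tau]. [K_small] bounds the variances by
    [tau ^+ 2]. *)
Let tau : R := g * delta / 4.
Hypothesis K_small : K%:R * Delta <= tau ^+ 2 / 2.

Let p (i : I) : R := mean m (fun s => \sum_j M s i j).
Let Phi (k : nat) : R := \sum_i p i * mean m (gain k i).

Let tau0 : 0 < tau. Proof. by rewrite divr_gt0// mulr_gt0. Qed.

(** Negating all signs reverses the edges, so a point has the same mean mass as head and as tail.
    This lets [Phi] recur with a single weight [p]. *)
Lemma p_col j : mean m (fun s => \sum_i M s i j) = p j.
Proof.
rewrite /p -(mean_negb m (fun s => \sum_i M s i j)).
by apply: eq_mean => s; apply: eq_bigr => i _.
Qed.

Lemma gain_cov k i (l : seq bool -> R) : (k <= K)%N -> (forall s, 0 <= l s <= w i) ->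
  `|mean m (fun s => l s * gain k i s) - mean m l * mean m (gain k i)| <= w i * tau.
Proof.
move=> kK lw; apply: mean_cov_le => //; apply: le_trans (gain_var k i) _.
have : k%:R * Delta <= K%:R * Delta by rewrite ler_wpM2r// ler_nat.
by move: K_small; lra.
Qed.

Lemma Phi_step k : (k < K)%N -> Phi k + 2 * tau <= Phi k.+1.
Proof.
move=> kK.
(* [gain_step] summed along the matching: heads contribute [gain k], tails [gain k.+1]. *)
have step s : g * (\sum_i \sum_j M s i j) + \sum_j (\sum_i M s i j) * gain k j s
    <= \sum_i (\sum_j M s i j) * gain k.+1 i s.
  under [X in _ + X]eq_bigr do rewrite mulr_suml.
  rewrite [X in _ + X]exchange_big mulr_sumr -big_split /=.
  apply: ler_sum => i _; rewrite mulr_sumr mulr_suml -big_split /=.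
  apply: ler_sum => j _.
  have [->|Mij] := eqVneq (M s i j) 0; first by rewrite mulr0 !mul0r addr0.
  have [gij dij] := Msupp Mij.
  rewrite (mulrC g) -mulrDr ler_wpM2l//.
  by apply: le_trans (gain_step k s dij); rewrite lerD2r.
have := mean_le m step; rewrite meanD meanZ !mean_sum => main.
have up : \sum_i mean m (fun s => (\sum_j M s i j) * gain k.+1 i s) <= Phi k.+1 + tau.
  rewrite /Phi -[tau]mul1r -w1 mulr_suml -big_split /=; apply: ler_sum => i _.
  have := @gain_cov k.+1 i (fun s => \sum_j M s i j) kK.
  rewrite ler_norml => /(_ _)/andP[s|_]; first by rewrite sumr_ge0//= Mrow.
  by rewrite -/(p i) lerBlDl.
have lo : Phi k - tau <= \sum_j mean m (fun s => (\sum_i M s i j) * gain k j s).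
  rewrite /Phi -[tau]mul1r -w1 mulr_suml -sumrB; apply: ler_sum => j _.
  have := @gain_cov k j (fun s => \sum_i M s i j) (ltnW kK).
  rewrite ler_norml => /(_ _)/andP[s|+ _]; first by rewrite sumr_ge0//= Mcol.
  by rewrite p_col; lra.
have mass : g * delta <= g * mean m (fun s => \sum_i \sum_j M s i j) by rewrite ler_pM2l.
rewrite mean_sum in mass.
have tauE : 4 * tau = g * delta by rewrite /tau; field.
by move: main up lo mass; lra.
Qed.

Lemma Phi_ge k : (k <= K)%N -> k%:R * (2 * tau) <= Phi k.
Proof.
elim: k => [_|k IH kK].
  rewrite mul0r; apply: sumr_ge0 => i _; apply: mulr_ge0.
    by rewrite -(mean_cst m 0); apply: mean_le => s; rewrite sumr_ge0.
  rewrite -(mean_cst m 0); apply: mean_le => s.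
  by apply: le_trans (gain_ge s (reach_refl 0 i)); rewrite subrr.
rewrite -natr1 mulrDl mul1r; apply: le_trans (Phi_step kK).
by rewrite lerD2r IH// ltnW.
Qed.

(** The linear growth of [Phi] meets the union bound on each [gain K i]. *)
Lemma chain_length_le : (1 < #|I|)%N -> K%:R <= Num.sqrt (ln #|I|%:R) :> R.
Proof.
move=> I1; set L := Num.sqrt _.
have ln0 : 0 < ln (#|I|%:R : R) by rewrite ln_gt0// ltr1n.
have L0 : 0 < L by rewrite sqrtr_gt0.
have L2 : L ^+ 2 = ln #|I|%:R by rewrite sqr_sqrtr// ltW.
have gainK i : mean m (gain K i) <= 2 * tau * L.
  (* This [lam] balances the two terms of [gain_mean_le]: each is at most [L ^+ 2]. *)
  have lam0 : 0 < L / tau by rewrite divr_gt0.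
  rewrite -(ler_pM2l lam0); apply: le_trans (gain_mean_le K i lam0) _.
  have c0 : 0 <= 2 * (L / tau) ^+ 2 by rewrite mulr_ge0// sqr_ge0.
  have := ler_wpM2l c0 K_small; rewrite -L2.
  have -> : 2 * (L / tau) ^+ 2 * (tau ^+ 2 / 2) = L ^+ 2 by field; rewrite gt_eqF.
  have -> : L / tau * (2 * tau * L) = 2 * L ^+ 2 by field; rewrite gt_eqF.
  by lra.
have p0 i : 0 <= p i by rewrite -(mean_cst m 0); apply: mean_le => s; rewrite sumr_ge0.
have p1 : \sum_i p i <= 1.
  rewrite -w1; apply: ler_sum => i _; rewrite -(mean_cst m (w i)); exact: mean_le.
have := Phi_ge (leqnn K).
have : Phi K <= \sum_i p i * (2 * tau * L).
  by apply: ler_sum => i _; rewrite ler_wpM2l.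
rewrite -mulr_suml => h1 h2.
have tL : 0 <= 2 * tau * L by rewrite !mulr_ge0// ltW.
have h3 := ler_wpM2r tL p1.
have t20 : 0 < 2 * tau by rewrite mulr_gt0.
by rewrite -(ler_pM2r t20); lra.
Qed.

End Chaining.

(** * The structure theorem *)

Section Structure.
Variables (R : realType) (I : finType) (m : nat) (v : I -> nat -> R) (w : I -> R).
Notation d := (sqdist m v).

Hypothesis w0 : forall i, 0 <= w i.
Hypothesis w1 : \sum_i w i = 1.
Hypothesis tri : forall i j k, d i k <= d i j + d j k.
Hypothesis centered : forall k, \sum_i w i * v i k = 0.
Hypothesis normalized : \sum_i w i * nrm m (v i) = 1.

(* [h] stands for any lower bound of the distance to [A]. *)
Definition spread (A : {set I}) (h : I -> R) : Prop :=
  (forall j, 0 <= h j) /\ (forall i j, i \in A -> h j <= d i j).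

Definition spread_mass (A : {set I}) (h : I -> R) : R :=
  (\sum_(i in A) w i) * \sum_j w j * h j.

(** By centering, the average is [nrm m (v i) + 1]. *)
Lemma mean_sqdist_ge1 i : 1 <= \sum_j w j * d i j.
Proof.
rewrite -normalized.
have -> : \sum_j w j * d i j = \sum_(k < m) (v i k ^+ 2 + \sum_j w j * v j k ^+ 2).
  under eq_bigr do rewrite mulr_sumr.
  rewrite exchange_big; apply: eq_bigr => k _ /=.
  transitivity (\sum_j (v i k ^+ 2 * w j + (- (2 * v i k) * (w j * v j k) + w j * v j k ^+ 2))).
    by apply: eq_bigr => j _; ring.
  by rewrite !big_split /= -!mulr_sumr w1 centered mulr1 mulr0 add0r.
under [X in X <= _]eq_bigr do rewrite mulr_sumr.
rewrite exchange_big; apply: ler_sum => k _ /=.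
by rewrite lerDr sqr_ge0.
Qed.

(** The mean distance from [i0] is at least 1, hence the mean excess over the radius [2^-1] is at
    least [2^-1]; the ball itself weighs at least [4^-1]. *)
Lemma spread_ball i0 :
  4^-1 <= \sum_(j | d i0 j <= 2^-1) w j ->
  exists A h, spread A h /\ 8^-1 <= spread_mass A h.
Proof.
move=> big_ball; exists [set j | d i0 j <= 2^-1]%SET, (fun j => Num.max 0 (d i0 j - 2^-1)).
split; first split=> [j|i j]; first by rewrite le_max lexx.
  rewrite inE => ii0; rewrite ge_max nrm_ge0/= lerBlDl.
  by apply: le_trans (tri _ i _) _; rewrite lerD2r.
rewrite /spread_mass.
have ballE : \sum_(i in [set j | d i0 j <= 2^-1]%SET) w i = \sum_(j | d i0 j <= 2^-1) w j.
  by apply: eq_bigl => j; rewrite inE.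
have far : 2^-1 <= \sum_j w j * Num.max 0 (d i0 j - 2^-1).
  apply: (@le_trans _ _ (\sum_j w j * (d i0 j - 2^-1))).
    under eq_bigr do rewrite mulrBr.
    by rewrite sumrB -mulr_suml w1 mul1r; have := mean_sqdist_ge1 i0; lra.
  by apply: ler_sum => j _; rewrite ler_wpM2l// le_max lexx orbT.
rewrite ballE; have -> : 8^-1 = 4^-1 * 2^-1 :> R by field.
by apply: ler_pM; rewrite ?invr_ge0.
Qed.

(** Points of norm at most [3^-1] are within squared distance [4 / 9] of each other, so one small
    ball contains them. The others weigh at least [3 / 4] and have mean absolute projection at least
    [6^-1] each. *)
Lemma mean_abs_ge :
  (forall i, \sum_(j | d i j <= 2^-1) w j < 4^-1) ->
  8^-1 <= mean m (fun s => \sum_i w i * `|dot (v i) s|).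
Proof.
move=> small; rewrite mean_sum.
have near : \sum_(i | nrm m (v i) <= 9^-1) w i <= 4^-1.
  have [i0 Pi0|P0] := pickP (fun i => nrm m (v i) <= 9^-1); last by rewrite big_pred0 ?invr_ge0.
  apply: le_trans (ltW (small i0)); rewrite big_mkcond [leRHS]big_mkcond.
  apply: ler_sum => i _; case: ifP => [Pi|_]; last by case: ifP.
  suff -> : d i0 i <= 2^-1 by [].
  apply: (@le_trans _ _ (2 * nrm m (v i0) + 2 * nrm m (v i))); last by lra.
  rewrite /sqdist /nrm !mulr_sumr -big_split /=; apply: ler_sum => k _.
  have := sqr_ge0 (v i0 k + v i k); nra.
have far : 3 / 4 <= \sum_(i | ~~ (nrm m (v i) <= 9^-1)) w i.
  by move: w1; rewrite (bigID (fun i => nrm m (v i) <= 9^-1)) /=; lra.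
apply: (@le_trans _ _ (\sum_(i | ~~ (nrm m (v i) <= 9^-1)) w i * 6^-1)).
  by rewrite -mulr_suml; lra.
rewrite big_mkcond; apply: ler_sum => i _; rewrite meanZ; case: ifP => [|_]; last first.
  by rewrite mulr_ge0// -(mean_cst m 0); apply: mean_le.
rewrite -ltNge => /ltW ni; rewrite ler_wpM2l//; apply: le_trans (mean_abs_dot _ _).
have : Num.sqrt (3^-1 ^+ 2) <= Num.sqrt (nrm m (v i)).
  by rewrite ler_wsqrtr//; apply: le_trans ni; rewrite le_eqVlt; apply/orP; left; apply/eqP; field.
rewrite sqrtr_sqr ger0_norm ?invr_ge0//; lra.
Qed.

(** The projections average to 0, so their positive parts carry half of the absolute sum. *)
Lemma half_abs_dot s :
  \sum_i w i * ((dot (v i) s + `|dot (v i) s|) / 2) = (\sum_i w i * `|dot (v i) s|) / 2.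
Proof.
have dot_mean : \sum_i w i * dot (v i) s = 0.
  under eq_bigr do rewrite -dotZ.
  by rewrite -(dot_sum _ (fun i k => w i * v i k)) dot0// => k; exact: centered.
rewrite mulr_suml; transitivity (\sum_i (w i * dot (v i) s / 2 + w i * `|dot (v i) s| / 2)).
  by apply: eq_bigr => i _; ring.
by rewrite big_split -!mulr_suml /= dot_mean mul0r add0r.
Qed.

(* [max 0 y] is at most [sg] below [sg], and at most [y^2 / 32 + 8] everywhere. *)
Lemma tail_mass (sg : R) (y : I -> R) : 0 < sg ->
  \sum_i w i * ((y i + `|y i|) / 2) = (\sum_i w i * `|y i|) / 2 ->
  16^-1 * (\sum_i w i * `|y i|) - 8^-1 * sg - 256^-1 * \sum_i w i * y i ^+ 2
    <= \sum_(i | sg <= y i) w i.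
Proof.
move=> sg0 halfE.
have : \sum_i w i * ((y i + `|y i|) / 2) <=
   \sum_i (w i * sg + (w i * y i ^+ 2 / 32 + (if sg <= y i then w i else 0) * 8)).
  apply: ler_sum => i _; have wi := w0 i.
  have h : (y i + `|y i|) / 2 <= sg + (y i ^+ 2 / 32 + (if sg <= y i then 1 else 0) * 8).
    have sq := sqr_ge0 (y i); case: (leP sg (y i)) => yi.
      rewrite ger0_norm; last by apply: le_trans yi; exact: ltW.
      have := sqr_ge0 (y i - 16); lra.
    have : `|y i| <= - y i \/ y i >= 0.
      by case: (leP 0 (y i)) => h; [right|left; rewrite ltr0_norm].
    case => [|/ger0_norm ->]; lra.
  have := ler_wpM2l wi h; case: ifP => _; lra.
rewrite halfE !big_split /= -!mulr_suml w1 mul1r -big_mkcond /=.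
lra.
Qed.

(** Eligible pairs run from projection at most [- 64^-1] to at least [64^-1]. After greedy matching,
    the unsaturated points of the two tails are at distance at least [Delta], so [fail] makes one of
    these two sets lighter than [eta]. The matching then covers all but [eta] of that tail. *)
Lemma matching_mass (Delta eta : R) s :
  0 < Delta -> 0 < eta ->
  (forall A h, spread A h -> spread_mass A h < eta ^+ 2 * Delta) ->
  exists M : I -> I -> R, [/\ forall i j, 0 <= M i j,
    forall i j, M i j != 0 -> 32^-1 <= dot (v j) s - dot (v i) s /\ d i j <= Delta,
    forall i, \sum_j M i j <= w i, forall j, \sum_i M i j <= w j &
    16^-1 * (\sum_i w i * `|dot (v i) s|) - 512^-1
      - 256^-1 * (\sum_i w i * dot (v i) s ^+ 2) - eta <= \sum_i \sum_j M i j].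
Proof.
move=> Delta0 eta0 fail; set x := fun i => dot (v i) s.
pose e i j := [&& 64^-1 <= - x i, 64^-1 <= x j & d i j <= Delta].
have [M [M0 Me Mrow Mcol sat]] := greedy_matching e w0.
exists M; split=> //.
  move=> i j Mij; have : e i j by apply: contraNT Mij => /Me ->.
  move=> /and3P[xi xj dij]; split=> //; rewrite -/(x i) -/(x j); lra.
set mass := \sum_i \sum_j M i j.
have massC : mass = \sum_j \sum_i M i j by rewrite /mass exchange_big.
(* By saturation, [L] and [Q] contain no eligible pair. *)
pose L := [set i | (64^-1 <= - x i) && (\sum_j M i j < w i)]%SET.
pose Q := [set j | (64^-1 <= x j) && (\sum_i M i j < w j)]%SET.
have LQ : spread L (fun j => if j \in Q then Delta else 0).
  split=> [j|i j]; first by case: ifP => // _; exact: ltW.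
  rewrite inE => /andP[xi ri]; case: ifP => [|_]; last exact: nrm_ge0.
  rewrite inE => /andP[xj cj]; rewrite leNgt; apply/negP => dij.
  have /sat[h|h] : e i j by rewrite /e xi xj ltW.
  - by move: ri; rewrite h ltxx.
  - by move: cj; rewrite h ltxx.
have covL : \sum_(i | 64^-1 <= - x i) w i <= \sum_(i in L) w i + mass.
  rewrite big_mkcond [X in X + _]big_mkcond -big_split /=; apply: ler_sum => i _.
  rewrite inE; have row0 : 0 <= \sum_j M i j by exact: sumr_ge0.
  case: ifP => _ /=; last by rewrite add0r.
  by case: ltP => h; [rewrite lerDl|rewrite add0r].
have covQ : \sum_(j | 64^-1 <= x j) w j <= \sum_(j in Q) w j + mass.
  rewrite massC big_mkcond [X in X + _]big_mkcond -big_split /=; apply: ler_sum => j _.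
  rewrite inE; have col0 : 0 <= \sum_i M i j by exact: sumr_ge0.
  case: ifP => _ /=; last by rewrite add0r.
  by case: ltP => h; [rewrite lerDl|rewrite add0r].
have LQ_small : (\sum_(i in L) w i) * (\sum_(j in Q) w j) < eta ^+ 2.
  have := fail _ _ LQ; rewrite /spread_mass.
  have -> : \sum_j w j * (if j \in Q then Delta else 0) = (\sum_(j in Q) w j) * Delta.
    rewrite mulr_suml [RHS]big_mkcond; apply: eq_bigr => j _.
    by case: ifP => _; rewrite ?mulr0.
  by rewrite mulrA ltr_pM2r.
have tailQ := @tail_mass 64^-1 x (ltac:(by [])) (half_abs_dot s).
have tailL : 16^-1 * (\sum_i w i * `|x i|) - 8^-1 * 64^-1 - 256^-1 * \sum_i w i * x i ^+ 2
    <= \sum_(i | 64^-1 <= - x i) w i.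
  have absN : \sum_i w i * `|- x i| = \sum_i w i * `|x i|.
    by apply: eq_bigr => i _; rewrite normrN.
  have sqrN : \sum_i w i * (- x i) ^+ 2 = \sum_i w i * x i ^+ 2.
    by apply: eq_bigr => i _; rewrite sqrrN.
  rewrite -absN -sqrN; apply: (@tail_mass 64^-1 (fun i => - x i)) => //=.
  (* Negated signs turn [half_abs_dot] into the same identity for [- x]. *)
  have negE i : dot (v i) (map negb s) = - x i by exact: dot_negb.
  rewrite -(eq_bigr _ (fun i _ => congr1 (fun z => w i * ((z + `|z|) / 2)) (negE i))).
  by rewrite half_abs_dot; congr (_ / 2); apply: eq_bigr => i _; rewrite negE.
have p512 : 8^-1 * 64^-1 = 512^-1 :> R by field.
rewrite -/x -[\sum_i w i * `|x i|]/(\sum_i w i * `|dot (v i) s|) in tailQ tailL *.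
rewrite p512 in tailQ tailL.
have [Ls|Ls] := ltP (\sum_(i in L) w i) eta.
  by move: covL tailL; lra.
have [Qs|Qs] := ltP (\sum_(j in Q) w j) eta.
  by move: covQ tailQ; lra.
have : eta ^+ 2 <= (\sum_(i in L) w i) * (\sum_(j in Q) w j).
  by rewrite expr2 ler_pM// ltW.
by rewrite leNgt LQ_small.
Qed.

(* Averaging a matching with the reverse of the one for [- s] gives each point the same
   mean mass as a tail and as a head. *)
Lemma symmetric_matching (Delta eta : R) :
  0 < Delta -> 0 < eta -> eta <= 1024^-1 ->
  (forall i, \sum_(j | d i j <= 2^-1) w j < 4^-1) ->
  (forall A h, spread A h -> spread_mass A h < eta ^+ 2 * Delta) ->
  exists M : seq bool -> I -> I -> R,
   [/\ (forall s i j, 0 <= M s i j) /\ (forall s i j, M (map negb s) i j = M s j i),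
    forall s i j, M s i j != 0 -> 32^-1 <= dot (v j) s - dot (v i) s /\ d i j <= Delta,
    forall s i, \sum_j M s i j <= w i, forall s j, \sum_i M s i j <= w j &
    1024^-1 <= mean m (fun s => \sum_i \sum_j M s i j)].
Proof.
move=> Delta0 eta0 eta1 small fail.
have /choice[N NP] := fun s => matching_mass s Delta0 eta0 fail.
have negbK' s : map negb (map negb s) = s.
  by rewrite -map_comp map_id_in// => b _ /=; rewrite negbK.
exists (fun s i j => (N s i j + N (map negb s) j i) / 2); split.
- split=> s i j; last by rewrite negbK' addrC.
  have [N0 _ _ _ _] := NP s; have [N0' _ _ _ _] := NP (map negb s).
  by rewrite divr_ge0// addr_ge0.
- move=> s i j; have [_ Ns _ _ _] := NP s; have [_ Ns' _ _ _] := NP (map negb s).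
  have [N0|/Ns//] := eqVneq (N s i j) 0; have [N0'|/Ns'] := eqVneq (N (map negb s) j i) 0.
    by rewrite N0 N0' addr0 mul0r eqxx.
  by rewrite !dot_negb sqdistC => -[h1 h2] _; split=> //; lra.
- move=> s i; have [_ _ r _ _] := NP s; have [_ _ _ c _] := NP (map negb s).
  by rewrite -mulr_suml big_split /=; move: (r i) (c i); lra.
- move=> s j; have [_ _ _ c _] := NP s; have [_ _ r _ _] := NP (map negb s).
  by rewrite -mulr_suml big_split /=; move: (c j) (r j); lra.
have massE s : \sum_i \sum_j (N s i j + N (map negb s) j i) / 2 =
   2^-1 * (\sum_i \sum_j N s i j) + 2^-1 * (\sum_i \sum_j N (map negb s) i j).
  rewrite [X in _ = _ + _ * X]exchange_big /= !mulr_sumr -big_split /=.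
  apply: eq_bigr => i _; rewrite !mulr_sumr -big_split /=.
  by apply: eq_bigr => j _; ring.
rewrite (eq_mean _ massE) meanD !meanZ.
rewrite (mean_negb m (fun s => \sum_i \sum_j N s i j)).
have low : mean m (fun s => 16^-1 * (\sum_i w i * `|dot (v i) s|) - 512^-1
      - 256^-1 * (\sum_i w i * dot (v i) s ^+ 2) - eta) <=
    mean m (fun s => \sum_i \sum_j N s i j).
  by apply: mean_le => s; have [] := NP s.
have sq : mean m (fun s => \sum_i w i * dot (v i) s ^+ 2) = 1.
  rewrite mean_sum -normalized; apply: eq_bigr => i _; rewrite meanZ; congr (_ * _).
  have := mean_dot_sqr m 0 (v i); rewrite expr0n add0r => <-.
  by apply: eq_mean => s; rewrite add0r.
(* [16^-1 * 8^-1], less [512^-1], [256^-1] and [eta <= 1024^-1], leaves at least [1024^-1]. *)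
move: low; rewrite !meanB !meanZ !mean_cst sq.
have := mean_abs_ge small; lra.
Qed.

End Structure.

(** Suppose every spread mass is smaller. The chain length [K] is taken just above [L], and [Delta]
    of order [1 / K] keeps [K * Delta] within the variance budget; [chain_length_le] then gives
    [K <= L], a contradiction. *)
Theorem arv_spread (R : realType) : exists2 c : R, 0 < c &
  forall (I : finType) (m : nat) (v : I -> nat -> R) (w : I -> R),
  (1 < #|I|)%N -> (forall i, 0 <= w i) -> \sum_i w i = 1 ->
  (forall i j k, sqdist m v i k <= sqdist m v i j + sqdist m v j k) ->
  (forall k, \sum_i w i * v i k = 0) -> \sum_i w i * nrm m (v i) = 1 ->
  exists A h, spread m v A h /\ c / Num.sqrt (ln #|I|%:R) <= spread_mass w A h.
Proof.
have [eta [eta0 eta1 etaE]] : exists eta : R, [/\ 0 < eta, eta <= 1 & eta = 1024^-1].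
  by exists 1024^-1; split; rewrite ?invr_gt0 ?ltr0n ?invf_le1 ?ler1n ?ltr0n.
(* This is [g * delta / 4] for the gain [g = 32^-1] and the mass [delta = 1024^-1]. *)
have [tau [tau0 tau1 tauE]] :
    exists tau : R, [/\ 0 < tau, tau <= 2^-1 & tau = 32^-1 * 1024^-1 / 4].
  by exists (32^-1 * eta / 4); split; [lra|lra|rewrite etaE].
pose V := tau ^+ 2 / 2.
have V0 : 0 < V by rewrite divr_gt0// exprn_gt0.
exists (eta ^+ 2 * V / 3); first by rewrite divr_gt0// mulr_gt0// exprn_gt0.
move=> I m v w I1 w0 w1 tri cent norm1; set L := Num.sqrt _.
(* [K] is at most [L + 1], and this bound turns that into [K <= 3 * L], the source of the 3 in the
   constant. *)
have L2 : 2^-1 <= L.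
  have -> : 2^-1 = Num.sqrt (2^-1 ^+ 2) :> R by rewrite sqrtr_sqr ger0_norm ?invr_ge0.
  rewrite ler_wsqrtr// -ler_expR lnK ?posrE ?ltr0n ?(ltn_trans _ I1)//.
  apply: (@le_trans _ _ 2); last by rewrite ler_nat.
  rewrite -[2^-1 ^+ 2]opprK expRN.
  have h := expR_ge1Dx (- (2^-1 ^+ 2) : R).
  rewrite invf_ple ?posrE ?expR_gt0//; apply: le_trans h; lra.
have L0 : 0 < L by apply: lt_le_trans L2; rewrite invr_gt0.
pose K := (Num.truncn L).+1.
have LK : L < K%:R by exact: truncnS_gt.
have KL : K%:R <= 3 * L.
  have : (Num.truncn L)%:R <= L by rewrite truncn_le// ltW.
  by rewrite /K -natr1; lra.
have K0 : 0 < K%:R :> R by rewrite ltr0n.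
pose Delta := V / K%:R; have Delta0 : 0 < Delta by rewrite divr_gt0.
apply: contrapT => none.
have fail A h : spread m v A h -> spread_mass w A h < eta ^+ 2 * V / 3 / L.
  move=> sp; rewrite ltNge; apply/negP => le; apply: none.
  by exists A, h.
have small i : \sum_(j | sqdist m v i j <= 2^-1) w j < 4^-1.
  rewrite ltNge; apply/negP => /(spread_ball w0 w1 tri cent norm1)[A [h [sp]]].
  apply/negP; rewrite -ltNge; apply: lt_le_trans (fail _ _ sp) _.
  rewrite ler_pdivrMr//.
  apply: (@le_trans _ _ (8^-1 * 2^-1)); last by rewrite ler_pM2l ?invr_gt0.
  have tau_sq : tau ^+ 2 <= 4^-1 by nra.
  have eta_sq : eta ^+ 2 <= 1 by nra.
  rewrite /V; have := sqr_ge0 tau; nra.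
have fail' A h : spread m v A h -> spread_mass w A h < eta ^+ 2 * Delta.
  move=> /fail h1; apply: lt_le_trans h1 _.
  have -> : eta ^+ 2 * V / 3 / L = eta ^+ 2 * V * (3 * L)^-1 by field; rewrite gt_eqF.
  rewrite /Delta mulrA ler_wpM2l//; first by rewrite mulr_ge0 ?sqr_ge0// ltW.
  by rewrite lef_pV2// posrE mulr_gt0.
have eta_le : eta <= 1024^-1 by rewrite etaE.
have [M [[M0 Msym] Msupp Mrow Mcol Mmass]] :=
  symmetric_matching w0 w1 cent norm1 Delta0 eta0 eta_le small fail'.
have KDelta : K%:R * Delta <= (32^-1 * 1024^-1 / 4) ^+ 2 / 2.
  by rewrite -tauE /Delta mulrC divfK// gt_eqF.
have g0 : 0 < 32^-1 :> R by rewrite invr_gt0 ltr0n.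
have delta0 : 0 < 1024^-1 :> R by rewrite invr_gt0 ltr0n.
have := chain_length_le w0 w1 tri (ltW Delta0) g0 delta0 M0 Msupp Mrow Mcol Msym Mmass KDelta I1.
by rewrite leNgt -/L LK.
Qed.

(** * Rounding *)

Section Median.
Variables (R : realFieldType) (I : finType) (w r : I -> R).

(** [t] is the largest value of [r] on [A] with at least half of the weight at or above it. Were
    less than half at or below [t], the next larger value would qualify too. *)
Lemma weighted_median (A : {set I}) i0 : i0 \in A -> (forall i, 0 <= w i) ->
  exists t, \sum_(i in A) w i <= 2 * \sum_(i in A | t <= r i) w i /\
            \sum_(i in A) w i <= 2 * \sum_(i in A | r i <= t) w i.
Proof.
move=> Ai0 w0.
pose P i := (i \in A) && (\sum_(j in A) w j <= 2 * \sum_(j in A | r i <= r j) w j).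
have sum_ge0 (Q : pred I) : 0 <= \sum_(j in A | Q j) w j by exact: sumr_ge0.
have [i1 Pi1] : exists i1, P i1.
  case: (@arg_minP _ R I i0 (mem A) r Ai0) => i Ai mini.
  have {}Ai : i \in A := Ai; exists i; rewrite /P Ai /=.
  have -> : \sum_(j in A | r i <= r j) w j = \sum_(j in A) w j.
    apply: eq_bigl => j; case: (boolP (j \in A)) => //= /mini ->; by [].
  have : 0 <= \sum_(j in A) w j by exact: sumr_ge0.
  lra.
case: (@arg_maxP _ R I i1 P r Pi1) => i /andP[Ai Pi] maxi.
exists (r i); split=> //; rewrite leNgt; apply/negP => low.
have split_r : \sum_(j in A) w j = \sum_(j in A | r j <= r i) w j + \sum_(j in A | r i < r j) w j.
  rewrite (bigID (fun j => r j <= r i)) /=; congr (_ + _).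
  by apply: eq_bigl => j; rewrite -ltNge.
have [j0 /andP[Aj0 rj0]|Q0] := pickP (fun j => (j \in A) && (r i < r j)); last first.
  move: low split_r; rewrite [X in _ + X]big_pred0// addr0 => low eq.
  by have := sum_ge0 (fun j => r j <= r i); move: low; rewrite eq; lra.
have Q0 : (j0 \in A) && (r i < r j0) by rewrite Aj0.
case: (@arg_minP _ R I j0 (fun j => (j \in A) && (r i < r j)) r Q0) => j /andP[Aj rj] minj.
have : P j.
  rewrite /P Aj /=.
  have -> : \sum_(k in A | r j <= r k) w k = \sum_(k in A | r i < r k) w k.
    apply: eq_bigl => k; case: (boolP (k \in A)) => //= Ak.
    by apply/idP/idP => [/(lt_le_trans rj)//|rk]; apply: minj; rewrite Ak.
  lra.
by move=> /maxi rji; have : r j <= r i := rji; rewrite leNgt rj.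
Qed.
End Median.

Section Rounding.
Variables (R : realType) (n : nat) (E : rel 'I_n) (pi : 'I_n -> R).
Hypothesis pi0 : forall i, 0 < pi i.

Let pi_ge0 i : 0 <= pi i. Proof. exact: ltW. Qed.
Notation P := (\sum_i pi i).

Lemma wt_ge0 S : 0 <= wt pi S.
Proof. exact: sumr_ge0. Qed.

Lemma wt_gt0 (S : {set 'I_n}) : S != finset.set0 -> 0 < wt pi S.
Proof.
move=> /set0Pn[i iS]; rewrite /wt (bigD1 i)//=.
by rewrite ltr_wpDr// sumr_ge0.
Qed.

Lemma wt_setC S : wt pi S + wt pi (~: S)%SET = P.
Proof.
rewrite /wt (bigID (mem S) predT) /=; congr (_ + _).
by apply: eq_bigl => i; rewrite inE.
Qed.

Lemma psi_set_ge0 S : 0 <= psi_set E pi S.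
Proof. by rewrite /psi_set divr_ge0// le_min !wt_ge0. Qed.

Lemma psi_graph_le S : S != finset.set0 -> S != [set: 'I_n]%SET ->
  psi_graph E pi <= psi_set E pi S.
Proof.
move=> S0 ST; apply: ge_inf; last by exists S => //=; rewrite S0 ST.
by exists 0 => _ [A _ <-]; exact: psi_set_ge0.
Qed.

Lemma psi_graph_ge0 : 0 <= psi_graph E pi.
Proof.
rewrite /psi_graph; set X := [set psi_set E pi S | S in _]%classic.
have [->|/set0P X0] := eqVneq X set0; first by rewrite inf0.
by apply: lb_le_inf => // _ [A _ <-]; exact: psi_set_ge0.
Qed.

(** The product form also covers the trivial sets, so it can be summed over level sets. It rests on
    [a * b <= (a + b) * Num.min a b]. *)
Lemma psi_graph_cut S :
  psi_graph E pi * (wt pi S * wt pi (~: S)%SET) <= P * wt pi (out_bd E S).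
Proof.
have [->|S0] := eqVneq S finset.set0.
  by rewrite /wt big_set0 mul0r mulr0 mulr_ge0 ?sumr_ge0.
have [->|ST] := eqVneq S [set: 'I_n]%SET.
  by rewrite finset.setCT /wt big_set0 !mulr0 mulr_ge0 ?sumr_ge0.
have a0 := wt_gt0 S0.
have b0 : 0 < wt pi (~: S)%SET.
  by apply: wt_gt0; apply: contra ST => /eqP h; rewrite -[S]finset.setCK h finset.setC0.
have min0 : 0 < Num.min (wt pi S) (wt pi (~: S)%SET) by rewrite lt_min a0.
have : psi_graph E pi * Num.min (wt pi S) (wt pi (~: S)%SET) <= wt pi (out_bd E S).
  rewrite -ler_pdivlMr//; apply: le_trans (psi_graph_le S0 ST) _.
  by rewrite /psi_set ler_pM2r ?invr_gt0// ge_min lexx.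
have prod_le : wt pi S * wt pi (~: S)%SET <= P * Num.min (wt pi S) (wt pi (~: S)%SET).
  rewrite -(wt_setC S); case: (leP (wt pi S)) => _; nra.
move=> h; apply: (@le_trans _ _ (psi_graph E pi * (P * Num.min (wt pi S) (wt pi (~: S)%SET)))).
  by rewrite ler_wpM2l// psi_graph_ge0.
by rewrite mulrCA ler_wpM2l// sumr_ge0.
Qed.

(** * Coarea inequality for level sets *)

Section Coarea.
Variable f : 'I_n -> R.

(** Integration over thresholds becomes a sum over the [n.-1] gaps of the sorted values. Repeated
    values give gaps 0, and the default of [nth] is not reached below index [n]. *)
Let lev (k : nat) : R := nth 0 (sort <=%R (codom f)) k.
Let gap k : R := lev k.+1 - lev k.
Let S k : {set 'I_n} := [set i | f i <= lev k]%SET.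

Let size_lev : size (sort <=%R (codom f)) = n.
Proof. by rewrite size_sort size_codom card_ord. Qed.

Let lev_le p q : (p <= q)%N -> (q < n)%N -> lev p <= lev q.
Proof.
move=> pq qn; apply: (sorted_leq_nth le_trans lexx) => //.
- exact: sort_le_sorted.
- by rewrite inE size_lev; apply: leq_ltn_trans qn.
- by rewrite inE size_lev.
Qed.

Let levP i : exists2 p, (p < n)%N & f i = lev p.
Proof.
have : f i \in sort <=%R (codom f) by rewrite mem_sort codom_f.
by move=> /(nthP 0)[p]; rewrite size_lev => pn <-; exists p.
Qed.

Let lev0_le i : lev 0 <= f i.
Proof. by have [p pn ->] := levP i; exact: lev_le. Qed.

Let le_lev_last i : f i <= lev n.-1.
Proof.
by have [p pn ->] := levP i; apply: lev_le; rewrite -ltnS prednK//; apply: leq_ltn_trans pn.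
Qed.

Let lev_next k i : (k.+1 < n)%N -> lev k < f i -> lev k.+1 <= f i.
Proof.
have [p pn ->] := levP i => kn kp; apply: lev_le => //; rewrite ltnNge; apply/negP => pk.
by move: kp; rewrite ltNge lev_le// ltnW.
Qed.

Let gap_ge0 k : (k.+1 < n)%N -> 0 <= gap k.
Proof. by move=> kn; rewrite subr_ge0 lev_le. Qed.

(** Increments of [clip lo hi] along the levels measure the part of each gap inside [[lo, hi]], and
    they telescope. *)
Let clip (lo hi x : R) : R := Num.max lo (Num.min hi x).

Let layer_ge i j :
  Num.max 0 (f j - f i) <= \sum_(k < n.-1) gap k * ((i \in S k) && (j \notin S k))%:R.
Proof.
have kn (k : 'I_n.-1) : (k.+1 < n)%N by rewrite -ltn_predRL.
rewrite ge_max sumr_ge0/= => [|k _]; last by rewrite mulr_ge0// gap_ge0.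
have [fji|fij] := leP (f j) (f i).
  by apply: (@le_trans _ _ 0); [rewrite subr_le0|apply: sumr_ge0 => k _; rewrite mulr_ge0// gap_ge0].
apply: (@le_trans _ _ (\sum_(k < n.-1) (clip (f i) (f j) (lev k.+1) - clip (f i) (f j) (lev k)))).
  rewrite -(big_mkord predT (fun k => clip (f i) (f j) (lev k.+1) - clip (f i) (f j) (lev k))).
  rewrite telescope_sumr// /clip (min_l (le_lev_last j)) (min_r (lev0_le j)).
  by rewrite (max_l (lev0_le i)) max_r// ltW.
apply: ler_sum => k _; rewrite !inE /gap.
have nx := lev_next (kn k); have mono : lev k <= lev k.+1 := lev_le (leqnSn k) (kn k).
case: (leP (f i) (lev k)) => ik.
  case: (leP (f j) (lev k)) => jk /=.
    rewrite mulr0 /clip !min_l ?subrr//; exact: le_trans jk mono.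
  have := nx _ jk => jk'; rewrite mulr1 /clip !min_r ?(ltW jk)// !max_r//.
  by apply: le_trans ik mono.
have := nx _ ik => ik'; rewrite /= mulr0 /clip !min_r ?max_l ?subrr//; lra.
Qed.

(** If [j] is on the boundary of [S k], the gap after [lev k] lies between [f j - q j] and [f j]. *)
Let layer_boundary_le (q : 'I_n -> R) (j : 'I_n) : 0 <= q j ->
  (forall i, E i j -> f j <= f i + q j) ->
  \sum_(k < n.-1) gap k * (j \in out_bd E (S k))%:R <= q j.
Proof.
have kn (k : 'I_n.-1) : (k.+1 < n)%N by rewrite -ltn_predRL.
move=> qj fq; pose c := clip (f j - q j) (f j).
apply: (@le_trans _ _ (\sum_(k < n.-1) (c (lev k.+1) - c (lev k)))).
  apply: ler_sum => k _; rewrite !inE /gap.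
  have nx := lev_next (kn k); have mono : lev k <= lev k.+1 := lev_le (leqnSn k) (kn k).
  case: (leP (f j) (lev k)) => jk /=.
    rewrite mulr0 /c /clip !min_l ?subrr//; exact: le_trans jk mono.
  have jk' := nx _ jk; case: existsP => [[i /andP[]]|_]; last first.
    rewrite mulr0 subr_ge0 /c /clip !min_r// ?(ltW jk)//.
    by rewrite ge_max le_max lexx/= le_max mono orbT.
  rewrite inE => ik /fq fji; rewrite mulr1 /c /clip !min_r// ?(ltW jk)// !max_r//; lra.
rewrite -(big_mkord predT (fun k => c (lev k.+1) - c (lev k))) telescope_sumr//.
have hi x : c x <= f j by rewrite ge_max ge_min lexx gerBl qj.
have lo x : f j - q j <= c x by rewrite le_max lexx.
by have := hi (lev n.-1); have := lo (lev 0); lra.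
Qed.

(** This is [psi_graph_cut] for the level sets, summed with the weights [gap k]. *)
Lemma coarea (q : 'I_n -> R) : (forall i, 0 <= q i) ->
  (forall i j, E i j -> f j <= f i + q j) ->
  psi_graph E pi * \sum_i \sum_j pi i * pi j * Num.max 0 (f j - f i)
    <= P * \sum_i pi i * q i.
Proof.
move=> q0 fq.
have kn (k : 'I_n.-1) : (k.+1 < n)%N by rewrite -ltn_predRL.
have cutE (k : 'I_n.-1) : wt pi (S k) * wt pi (~: S k)%SET =
  \sum_i \sum_j pi i * pi j * ((i \in S k) && (j \notin S k))%:R.
  rewrite /wt big_distrl big_mkcond /=; apply: eq_bigr => i _.
  case: ifP => _ /=; last by rewrite big1// => j _; rewrite mulr0.
  rewrite big_distrr big_mkcond /=; apply: eq_bigr => j _; rewrite inE.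
  by case: (j \in S k); rewrite /= ?mulr0 ?mulr1.
apply: (@le_trans _ _ (psi_graph E pi * \sum_(k < n.-1) gap k * (wt pi (S k) * wt pi (~: S k)%SET))).
  rewrite ler_wpM2l ?psi_graph_ge0//.
  under [leRHS]eq_bigr do rewrite cutE mulr_sumr.
  rewrite [leRHS]exchange_big; apply: ler_sum => i _ /=.
  under [leRHS]eq_bigr do rewrite mulr_sumr.
  rewrite [leRHS]exchange_big; apply: ler_sum => j _ /=.
  under [leRHS]eq_bigr do rewrite mulrCA.
  by rewrite -mulr_sumr ler_wpM2l ?mulr_ge0 ?layer_ge.
apply: (@le_trans _ _ (P * \sum_(k < n.-1) gap k * wt pi (out_bd E (S k)))).
  rewrite !mulr_sumr; apply: ler_sum => k _; rewrite ![_ * (gap k * _)]mulrCA.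
  by rewrite ler_wpM2l ?gap_ge0// psi_graph_cut.
rewrite ler_wpM2l ?sumr_ge0//.
have -> : \sum_(k < n.-1) gap k * wt pi (out_bd E (S k)) =
    \sum_j pi j * \sum_(k < n.-1) gap k * (j \in out_bd E (S k))%:R.
  under [RHS]eq_bigr do rewrite mulr_sumr.
  rewrite [RHS]exchange_big; apply: eq_bigr => k _ /=.
  rewrite /wt mulr_sumr big_mkcond; apply: eq_bigr => j _ /=.
  by case: ifP => _; rewrite ?mulr1 ?mulr0// mulrC.
by apply: ler_sum => j _; rewrite ler_wpM2l// layer_boundary_le// => i; exact: fq.
Qed.

End Coarea.

(* With [W i j = d i j / 2 + r i - r j], which obeys the triangle inequality and is
   at most [q j] on edges, the cuts are the level sets of [min_(i in A') W i j], resp.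
   of [- min_(i in A') W j i], for the half [A'] of [A] above, resp. below, a median of [r]. *)
Lemma rounding (d : 'I_n -> 'I_n -> R) (q r : 'I_n -> R) (A : {set 'I_n}) (h : 'I_n -> R) :
  (forall i, d i i = 0) -> (forall i j, d i j = d j i) ->
  (forall i j k, d i k <= d i j + d j k) -> (forall i, 0 <= q i) ->
  (forall i j, E i j -> d i j / 2 <= q j + r j - r i) ->
  (forall j, 0 <= h j) -> (forall i j, i \in A -> h j <= d i j) ->
  psi_graph E pi * ((\sum_(i in A) pi i) * \sum_j pi j * h j)
    <= 8 * (P * \sum_i pi i * q i).
Proof.
move=> dxx dC dtri q0 dual h0 hA.
have PD0 : 0 <= P * \sum_i pi i * q i.
  by rewrite mulr_ge0 ?sumr_ge0// => i _; rewrite mulr_ge0.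
have [->|/set0Pn[a0 Aa0]] := eqVneq A finset.set0.
  by rewrite big_set0 mul0r mulr0 mulr_ge0.
have [t [tup tdown]] := weighted_median r Aa0 pi_ge0.
pose W i j := d i j / 2 + r i - r j.
have Wtri i j k : W i k <= W i j + W j k by rewrite /W; have := dtri i j k; lra.
have WE i j : E i j -> W i j <= q j by move=> /dual; rewrite /W; lra.
have Wxx i : W i i = 0 by rewrite /W dxx mul0r add0r subrr.
have h_split : \sum_j pi j * h j <=
    \sum_(j | r j <= t) pi j * h j + \sum_(j | t <= r j) pi j * h j.
  rewrite (bigID (fun j => r j <= t)) /= lerD2l big_mkcond [leRHS]big_mkcond /=.
  apply: ler_sum => j _; rewrite -ltNge; case: ltP => [/ltW ->//|_].
  by case: ifP => // _; rewrite mulr_ge0.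
pose a := \sum_(i in A) pi i; have a0_ge : 0 <= a by exact: sumr_ge0.
have psi0 := psi_graph_ge0.
have a_gt0 : 0 < a by rewrite /a (bigD1 a0)//= ltr_wpDr// sumr_ge0.
(* A test function that is [<= 0] on [X] and [>= h / 2] on [Y], or the reverse. *)
have pairs (X Y : pred 'I_n) (f : 'I_n -> 'I_n -> R) :
    (forall i j, 0 <= f i j) -> (forall i j, X i -> Y j -> h j / 2 <= f i j) ->
    (\sum_(i | X i) pi i) * (\sum_(j | Y j) pi j * h j) / 2
      <= \sum_i \sum_j pi i * pi j * f i j.
  move=> f0 fXY; rewrite -mulrA big_distrl /= [leLHS]big_mkcond; apply: ler_sum => i _.
  case: ifP => Xi; last by apply: sumr_ge0 => j _; rewrite !mulr_ge0.
  rewrite mulr_suml mulr_sumr [leLHS]big_mkcond; apply: ler_sum => j _.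
  case: ifP => Yj; last by rewrite !mulr_ge0.
  by rewrite -!mulrA ler_wpM2l// ler_wpM2l// fXY.
have up : psi_graph E pi * ((\sum_(i in A | t <= r i) pi i) * (\sum_(j | r j <= t) pi j * h j) / 2)
   <= P * \sum_i pi i * q i.
  have [i1 Ai1] : exists i1, (i1 \in A) && (t <= r i1).
    apply/existsP; apply: contraT => /existsPn none.
    by move: tup; rewrite [X in _ * X]big_pred0 -/a => [|i]; [lra|exact/negbTE/none].
  pose f j := W [arg min_(i < i1 | (i \in A) && (t <= r i)) W i j]%O j.
  have f_le i j : (i \in A) && (t <= r i) -> f j <= W i j.
    by move=> Pi; rewrite /f; case: arg_minP => // k _; apply.
  have fP j : exists2 i, (i \in A) && (t <= r i) & f j = W i j.
    by rewrite /f; case: arg_minP => // k Pk _; exists k.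
  apply: le_trans (@coarea f q q0 _); last first.
    move=> j k jk; have [i Pi ->] := fP j; apply: le_trans (f_le _ _ Pi) _.
    by apply: le_trans (Wtri i j k) _; rewrite lerD2l WE.
  rewrite ler_wpM2l//; apply: pairs => [i j|i j Pi rj]; first by rewrite le_max lexx.
  rewrite le_max; apply/orP; right.
  (* On the half, [f i <= W i i = 0]; at [j], [r j <= t <= r k] leaves at least [d k j / 2]. *)
  have := f_le _ i Pi; rewrite Wxx; have [k /andP[Ak rk] ->] := fP j.
  by have := hA _ j Ak; rewrite /W; lra.
have down : psi_graph E pi * ((\sum_(i in A | r i <= t) pi i) * (\sum_(j | t <= r j) pi j * h j) / 2)
   <= P * \sum_i pi i * q i.
  have [i1 Ai1] : exists i1, (i1 \in A) && (r i1 <= t).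
    apply/existsP; apply: contraT => /existsPn none.
    by move: tdown; rewrite [X in _ * X]big_pred0 -/a => [|i]; [lra|exact/negbTE/none].
  pose f j := W j [arg min_(i < i1 | (i \in A) && (r i <= t)) W j i]%O.
  have f_le i j : (i \in A) && (r i <= t) -> f j <= W j i.
    by move=> Pi; rewrite /f; case: arg_minP => // k _; apply.
  have fP j : exists2 i, (i \in A) && (r i <= t) & f j = W j i.
    by rewrite /f; case: arg_minP => // k Pk _; exists k.
  apply: le_trans (@coarea (fun j => - f j) q q0 _); last first.
    move=> j k jk; have [i Pi fk] := fP k.
    by have := f_le _ j Pi; have := Wtri j k i; have := WE _ _ jk; rewrite fk; lra.
  (* The sums are swapped because this test function increases from the far points towards the half
     of [A]. *)
  rewrite ler_wpM2l// exchange_big /=.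
  under [leRHS]eq_bigr do under eq_bigr do rewrite (mulrC (pi _) (pi _)).
  apply: pairs => [i j|i j Pi rj]; first by rewrite le_max lexx.
  rewrite le_max; apply/orP; right.
  have := f_le _ i Pi; rewrite Wxx; have [k /andP[Ak rk] ->] := fP j.
  by have := hA _ j Ak; rewrite dC /W; lra.
move: tup tdown up down h_split; rewrite -/a.
set h1 := \sum_(j | r j <= t) _; set h2 := \sum_(j | t <= r j) _.
set a1 := \sum_(i in A | t <= _) _; set a2 := \sum_(i in A | _ <= t) _.
move=> a1_ge a2_ge up down hs.
have h1_0 : 0 <= h1 by apply: sumr_ge0 => j _; rewrite mulr_ge0.
have h2_0 : 0 <= h2 by apply: sumr_ge0 => j _; rewrite mulr_ge0.
(* The median and the halving of [h] each cost a factor 2, so either side accounts for 4 of the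
   final 8. *)
have : a * \sum_j pi j * h j <= 2 * (a1 * h1) + 2 * (a2 * h2).
  have := ler_wpM2l a0_ge hs; have := ler_wpM2r h1_0 a1_ge; have := ler_wpM2r h2_0 a2_ge; lra.
by move=> /(ler_wpM2l psi0); lra.
Qed.

End Rounding.

(** * Duality *)

Section Flows.
Variables (R : realType) (n : nat) (E : rel 'I_n) (pi : 'I_n -> R).
Hypothesis pi0 : forall i, 0 < pi i.

Let pi_ge0 i : 0 <= pi i. Proof. exact: ltW. Qed.
Notation P := (\sum_i pi i).

Lemma sum_indicator (N p : nat) (x : nat -> R) : (p < N)%N ->
  \sum_(l < N) ((l : nat) == p)%:R * x l = x p.
Proof.
move=> pN; rewrite (bigD1 (Ordinal pN))//= eqxx mul1r big1 ?addr0// => l lp.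
suff /negPf-> : (l : nat) != p by rewrite mul0r.
by apply: contra lp => /eqP h; apply/eqP/val_inj.
Qed.

(** Farkas' lemma for the system in [q] and [r]. Were it infeasible, the multipliers would be a
    circulation [F] and a scale [s] of the capacities, and [F / s] a flow of value above [D]. *)
Lemma flow_duality (d : 'I_n -> 'I_n -> R) (D : R) :
  (forall F, flow_ok E pi F -> \sum_i \sum_(j | E i j) F i j * (d i j / 2) <= D) ->
  exists q r : 'I_n -> R, [/\ forall i, 0 <= q i,
    forall i j, E i j -> d i j / 2 <= q j + r j - r i & \sum_i pi i * q i <= D].
Proof.
move=> flowD; apply: contrapT => none.
(* The variable [q i] has index [i] and [r i] has index [n + i]. *)
pose a (c : 'I_n + 'I_n * 'I_n + unit) (l : nat) : R :=
  match c with
  | inl (inl i) => - (l == i)%:R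
  | inl (inr (i, j)) => (E i j)%:R * ((l == n + i)%N%:R - (l == j)%:R - (l == n + j)%N%:R)
  | inr _ => \sum_i pi i * (l == i)%:R
  end.
pose b (c : 'I_n + 'I_n * 'I_n + unit) : R :=
  match c with
  | inl (inl i) => 0
  | inl (inr (i, j)) => (E i j)%:R * - (d i j / 2)
  | inr _ => D
  end.
have lt_l (i : 'I_n) : (i < n + n)%N by rewrite ltn_addr.
have lt_r (i : 'I_n) : (n + i < n + n)%N by rewrite ltn_add2l.
have [x|y [y0 ya yb]] := @farkas _ (n + n) _ a b.
  apply: contrapT => /forallNP feas; apply: none.
  exists (fun i => x i), (fun i => x (n + i)%N); split=> [i|i j Eij|].
  - have /negP := feas (inl (inl i)); rewrite -leNgt /=.
    under eq_bigr do rewrite mulNr.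
    by rewrite sumrN sum_indicator// oppr_le0.
  - have /negP := feas (inl (inr (i, j))); rewrite -leNgt /= Eij !mul1r.
    under eq_bigr do rewrite mul1r !mulrBl.
    by rewrite !sumrB !sum_indicator//; lra.
  - have /negP := feas (inr tt); rewrite -leNgt /=.
    under eq_bigr do rewrite mulr_suml.
    rewrite exchange_big /=.
    under eq_bigr => i _ do (under eq_bigr do rewrite -mulrA; rewrite -mulr_sumr sum_indicator//).
    by [].
pose F i j := y (inl (inr (i, j))); pose s := y (inr tt).
have sumE (t : 'I_n + 'I_n * 'I_n + unit -> R) : \sum_c y c * t c =
    \sum_i y (inl (inl i)) * t (inl (inl i)) + \sum_i \sum_j F i j * t (inl (inr (i, j)))
    + s * t (inr tt).
  rewrite !big_sumType /=; congr (_ + _ + _).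
    by rewrite pair_bigA; apply: eq_bigr => -[].
  by rewrite (bigD1 tt)//= big1 ?addr0// => -[].
(* The column of [q j] is the capacity constraint, with the multiplier of [0 <= q j] as slack. *)
have colE (j : 'I_n) : \sum_(i | E i j) F i j = s * pi j - y (inl (inl j)).
  have := ya j (lt_l j); rewrite sumE /=.
  have -> : \sum_i y (inl (inl i)) * - ((j : nat) == i)%:R = - y (inl (inl j)).
    rewrite (bigD1 j)//= eqxx big1 ?addr0 ?mulrN1// => i ij.
    by rewrite (inj_eq val_inj) eq_sym (negPf ij) oppr0 mulr0.
  have -> : \sum_i pi i * ((j : nat) == i)%:R = pi j.
    rewrite (bigD1 j)//= eqxx big1 ?addr0 ?mulr1// => i ij.
    by rewrite (inj_eq val_inj) eq_sym (negPf ij) mulr0.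
  have -> : \sum_i \sum_j0 F i j0 *
     ((E i j0)%:R * (((j : nat) == (n + i)%N)%:R - ((j : nat) == j0)%:R - ((j : nat) == (n + j0)%N)%:R))
     = - \sum_(i | E i j) F i j.
    have jn (i : 'I_n) : ((j : nat) == (n + i)%N) = false.
      by apply/negbTE; rewrite neq_ltn (leq_trans (ltn_ord j))// leq_addr.
    rewrite -sumrN [RHS]big_mkcond; apply: eq_bigr => i _.
    rewrite (bigD1 j)//= big1 => [|j0 jj0]; rewrite !jn.
      by rewrite eqxx addr0; case: (E i j); rewrite /= ?mul0r ?mulr0// mul1r !sub0r subr0 mulrN1.
    by rewrite (inj_eq val_inj) eq_sym (negPf jj0) !subr0 !mulr0.
  lra.
(* The column of [r i] is conservation of flow. *)
have consE (i : 'I_n) : \sum_(j | E i j) F i j = \sum_(j | E j i) F j i.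
  have := ya (n + i)%N (lt_r i); rewrite sumE /=.
  have jn (j : 'I_n) : ((n + i)%N == j) = false.
    by apply/negbTE; rewrite neq_ltn (leq_trans (ltn_ord j)) ?orbT// leq_addr.
  rewrite big1 => [|j _]; last by rewrite jn oppr0 mulr0.
  rewrite [X in s * X]big1 => [|j _]; last by rewrite jn mulr0.
  rewrite mulr0 addr0 add0r.
  have -> : \sum_i0 \sum_j F i0 j * ((E i0 j)%:R *
     (((n + i)%N == (n + i0)%N)%:R - ((n + i)%N == j)%:R - ((n + i)%N == (n + j)%N)%:R))
   = \sum_(j | E i j) F i j - \sum_(j | E j i) F j i.
    transitivity (\sum_i0 \sum_j (F i0 j * (E i0 j)%:R * (i == i0)%:R
        - F i0 j * (E i0 j)%:R * (i == j)%:R)).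
      apply: eq_bigr => k _; apply: eq_bigr => j _.
      by rewrite !eqn_add2l !(inj_eq val_inj) jn subr0; ring.
    under eq_bigr do rewrite sumrB.
    rewrite sumrB; congr (_ - _).
      rewrite (bigD1 i)//= [X in _ + X]big1 ?addr0 => [|k ki].
        rewrite [RHS]big_mkcond; apply: eq_bigr => j _.
        by rewrite eqxx mulr1; case: ifP => _; rewrite ?mulr1 ?mulr0.
      by rewrite big1// => j _; rewrite eq_sym (negPf ki) mulr0.
    rewrite [RHS]big_mkcond; apply: eq_bigr => k _.
    rewrite (bigD1 i)//= [X in _ + X]big1 ?addr0 => [|j ji].
      by rewrite eqxx mulr1; case: ifP => _; rewrite ?mulr1 ?mulr0.
    by rewrite eq_sym (negPf ji) mulr0.
  by move/eqP; rewrite subr_eq0 => /eqP.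
have value : s * D < \sum_i \sum_(j | E i j) F i j * (d i j / 2).
  move: yb; rewrite sumE /=.
  rewrite big1 => [|i _]; last by rewrite mulr0.
  have -> : \sum_i \sum_j F i j * ((E i j)%:R * - (d i j / 2)) =
     - \sum_i \sum_(j | E i j) F i j * (d i j / 2).
    rewrite -sumrN; apply: eq_bigr => i _; rewrite -sumrN [RHS]big_mkcond.
    by apply: eq_bigr => j _; case: ifP => _; rewrite ?mul0r ?mulr0// mul1r mulrN.
  lra.
have F0 i j : 0 <= F i j by exact: y0.
have colle j : \sum_(i | E i j) F i j <= s * pi j.
  by rewrite colE gerBl.
have s_ge0 : 0 <= s := y0 _.
(* Zero capacities force a zero flow, against [value]. *)
have [s0|s0] := eqVneq s 0.
  move: value; rewrite s0 mul0r ltNge => /negP; apply.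
  rewrite big1// => i _; rewrite big1// => j Eij.
  have : F i j <= 0.
    apply: le_trans (_ : \sum_(i | E i j) F i j <= 0); last by have := colle j; rewrite s0 mul0r.
    by rewrite (bigD1 i)//= lerDl sumr_ge0.
  by move=> Fle; rewrite (le_anti (_ : F i j <= 0 <= F i j)) ?mul0r// Fle F0.
have s_gt0 : 0 < s by rewrite lt_neqAle eq_sym s0.
have ok : flow_ok E pi (fun i j => F i j / s).
  split; first by move=> i j _; rewrite divr_ge0.
  split=> i; first by rewrite -!mulr_suml consE.
  by rewrite -mulr_suml consE ler_pdivrMr// mulrC.
have := flowD _ ok; rewrite leNgt => /negP; apply.
suff -> : \sum_i \sum_(j | E i j) F i j / s * (d i j / 2) =
    (\sum_i \sum_(j | E i j) F i j * (d i j / 2)) / s by rewrite ltr_pdivlMr// mulrC.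
rewrite mulr_suml; apply: eq_bigr => i _; rewrite mulr_suml; apply: eq_bigr => j _; ring.
Qed.

Lemma sqnorm_ge0 (x : 'rV[R]_n) : 0 <= sqnorm x.
Proof. by apply: sumr_ge0 => k _; exact: sqr_ge0. Qed.

Lemma flow_energy_le (v : 'I_n -> 'rV[R]_n) F : flow_ok E pi F ->
  flow_energy E F v <= max_flow_energy E pi v.
Proof.
move=> ok; apply: ub_le_sup; last by exists F.
(* [sup] dominates its set only if that is bounded above; an edge carries at most the capacity of
   its tail. *)
exists (2^-1 * \sum_(i < n) \sum_(j < n | E i j) pi i * sqnorm (v i - v j)) => _ [G [G0 [_ Gcap]] <-].
rewrite ler_wpM2l ?invr_ge0// ler_sum// => i _; rewrite ler_sum// => j Eij.
rewrite ler_wpM2r ?sqnorm_ge0//; apply: le_trans (Gcap i).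
by rewrite (bigD1 j)//= lerDl sumr_ge0// => k /andP[Eik _]; exact: G0.
Qed.

Lemma zero_flow_ok : flow_ok E pi (fun _ _ => 0).
Proof. by split=> //; split=> i; rewrite !big1. Qed.

Lemma max_flow_energy_ge0 v : 0 <= max_flow_energy E pi v.
Proof.
apply: le_trans (flow_energy_le v zero_flow_ok).
by rewrite /flow_energy big1 ?mulr0// => i _; rewrite big1// => j _; rewrite mul0r.
Qed.

Lemma lambda_dv_le v : feasible pi v -> lambda_dv E pi <= max_flow_energy E pi v.
Proof.
move=> fv; apply: ge_inf; last by exists v.
by exists 0 => _ [u _ <-]; exact: max_flow_energy_ge0.
Qed.

(** Flow leaving [S] enters a boundary vertex, whose capacity bounds its whole inflow. *)
Lemma flow_cut F (S : {set 'I_n}) : flow_ok E pi F ->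
  \sum_(i in S) \sum_(j | E i j && (j \notin S)) F i j <= wt pi (out_bd E S).
Proof.
move=> [F0 [cons cap]].
have -> : \sum_(i in S) \sum_(j | E i j && (j \notin S)) F i j =
    \sum_(j | j \notin S) \sum_(i | E i j && (i \in S)) F i j.
  rewrite (exchange_big_dep (fun j => j \notin S)) /= => [|i j _ /andP[]//].
  by apply: eq_bigr => j nj; apply: eq_bigl => i; rewrite nj andbT andbC.
rewrite /wt big_mkcond [leRHS]big_mkcond; apply: ler_sum => j _; rewrite inE.
case: ifP => //= nj; case: existsP => [_|none].
  apply: le_trans (cap j); rewrite cons big_mkcond [leRHS]big_mkcond; apply: ler_sum => i _.
  by case: (boolP (E i j)) => //= Eij; case: ifP => // _; exact: F0.
by rewrite big_pred0// => i; apply/negbTE/negP => /andP[Eij iS]; apply: none; exists i; rewrite iS.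
Qed.

(** Sum conservation over [S]; the edges inside cancel. The crossing flow is thus bounded by both
    vertex boundaries in [psi_set]. *)
Lemma flow_cut_sym F (S : {set 'I_n}) : flow_ok E pi F ->
  \sum_(i in S) \sum_(j | E i j && (j \notin S)) F i j =
  \sum_(i | i \notin S) \sum_(j | E i j && (j \in S)) F i j.
Proof.
move=> [F0 [cons cap]].
have : \sum_(i in S) \sum_(j | E i j) F i j = \sum_(i in S) \sum_(j | E j i) F j i.
  by apply: eq_bigr => i _; exact: cons.
under eq_bigr do rewrite (bigID (mem S)) /=.
under [in RHS]eq_bigr do rewrite (bigID (mem S)) /=.
rewrite !big_split /=.
have -> : \sum_(i in S) \sum_(j | E j i && (j \in S)) F j i =
    \sum_(i in S) \sum_(j | E i j && (j \in S)) F i j.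
  rewrite (exchange_big_dep (mem S)) /= => [|i j _ /andP[]//].
  by apply: eq_bigr => j jS; apply: eq_bigl => i; rewrite jS andbT andbC.
have -> : \sum_(i in S) \sum_(j | E j i && (j \notin S)) F j i =
    \sum_(i | i \notin S) \sum_(j | E i j && (j \in S)) F i j.
  rewrite (exchange_big_dep (fun j => j \notin S)) /= => [|i j _ /andP[]//].
  by apply: eq_bigr => j jS; apply: eq_bigl => i; rewrite jS andbT andbC.
by move/addrI.
Qed.

(** * Two-valued embeddings and the upper bound on [lambda_dv] *)

Section CutVector.
Variables (k0 : 'I_n) (S : {set 'I_n}).
Hypotheses (S0 : S != finset.set0) (ST : S != [set: 'I_n]%SET).

Let p := wt pi S.
Let q := wt pi (~: S)%SET.
(** The values [q * t] on [S] and [- p * t] off it average to 0, and this [t] makes the second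
    moment 1. *)
Let t := (Num.sqrt (p * q * P))^-1.
Let x i : R := if i \in S then q * t else - p * t.

Definition cut_vector (i : 'I_n) : 'rV[R]_n := x i *: delta_mx ord0 k0.

Let p0 : 0 < p. Proof. exact: wt_gt0. Qed.
Let q0 : 0 < q.
Proof.
by apply: wt_gt0 => //; apply: contra ST => /eqP h; rewrite -[S]finset.setCK h finset.setC0.
Qed.
Let pqP : p + q = P. Proof. exact: wt_setC. Qed.
Let P0 : 0 < P. Proof. by rewrite -pqP addr_gt0. Qed.

Let t_sqr : p * q * P * t ^+ 2 = 1.
Proof.
have pos : 0 < p * q * P by rewrite !mulr_gt0.
by rewrite /t exprVn sqr_sqrtr ?divff ?gt_eqF// ltW.
Qed.

Let sqnormZ (c : R) : sqnorm (c *: delta_mx ord0 k0 : 'rV[R]_n) = c ^+ 2.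
Proof.
rewrite /sqnorm (bigD1 k0)//= !mxE !eqxx mulr1 big1 ?addr0// => k kk0.
by rewrite !mxE (negPf kk0) andbF mulr0 expr0n.
Qed.

Let sum_x (g : R -> R) : \sum_i pi i * g (x i) = p * g (q * t) + q * g (- p * t).
Proof.
rewrite (bigID (mem S)) /=; congr (_ + _).
  by rewrite /p /wt mulr_suml; apply: eq_bigr => i iS; rewrite /x iS.
rewrite /q /wt mulr_suml; apply: eq_big => [i|i iS]; first by rewrite inE.
by rewrite /x (negPf iS).
Qed.

Lemma cut_vector_feasible : feasible pi cut_vector.
Proof.
split; last split.
- under eq_bigr do rewrite /cut_vector scalerA.
  rewrite -scaler_suml (sum_x id) /=.
  have -> : p * (q * t) + q * (- p * t) = 0 by ring.
  by rewrite scale0r.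
- under eq_bigr do rewrite /cut_vector sqnormZ.
  rewrite (sum_x (fun z => z ^+ 2)) -t_sqr -pqP; ring.
- move=> i j k; rewrite /cut_vector -!scalerBl !sqnormZ /x.
  by do 3! case: ifP => _; rewrite ?subrr; have := sqr_ge0 (q * t - - p * t);
     have := sqr_ge0 (- p * t - q * t); rewrite ?expr0n /=; lra.
Qed.

(** Only crossing edges count, at squared length [(P * t) ^+ 2 = P / (p * q)]. Both directions carry
    the same flow, which cancels the factor [2^-1]. *)
Lemma cut_vector_energy F : flow_ok E pi F ->
  flow_energy E F cut_vector = P / (p * q) * \sum_(i in S) \sum_(j | E i j && (j \notin S)) F i j.
Proof.
move=> ok; set c := \sum_(i in S) _.
have d2 : (q * t - - p * t) ^+ 2 = P / (p * q).
  have -> : q * t - - p * t = P * t by rewrite -pqP; ring.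
  have pq0 : p * q != 0 by rewrite gt_eqF// mulr_gt0.
  apply: (mulfI pq0); rewrite [RHS]mulrCA divff// mulr1.
  by rewrite -[RHS]mulr1 -t_sqr; ring.
have cross (Q1 Q2 : pred 'I_n) : (forall i j, Q1 i -> Q2 j -> (x i - x j) ^+ 2 = P / (p * q)) ->
  \sum_(i | Q1 i) \sum_(j | E i j && Q2 j) F i j * (x i - x j) ^+ 2 =
  P / (p * q) * \sum_(i | Q1 i) \sum_(j | E i j && Q2 j) F i j.
  move=> h; rewrite mulr_sumr; apply: eq_bigr => i Qi; rewrite mulr_sumr.
  by apply: eq_bigr => j /andP[_ Qj]; rewrite h// mulrC.
have flat (Q1 : pred 'I_n) (Q2 : pred 'I_n) : (forall i j, Q1 i -> Q2 j -> x i = x j) ->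
  \sum_(i | Q1 i) \sum_(j | E i j && Q2 j) F i j * (x i - x j) ^+ 2 = 0.
  move=> h; rewrite big1// => i Qi; rewrite big1// => j /andP[_ Qj].
  by rewrite (h i j)// subrr expr0n mulr0.
rewrite /flow_energy.
under eq_bigr do under eq_bigr do rewrite /cut_vector -scalerBl sqnormZ.
rewrite (bigID (mem S)) /=.
under eq_bigr do rewrite (bigID (mem S)) /=.
under [X in _ + X]eq_bigr do rewrite (bigID (mem S)) /=.
rewrite !big_split /= (flat (fun i => i \in S) (fun i => i \in S)) => [|i j iS jS]; last by rewrite /x iS jS.
rewrite (flat (fun i => i \notin S) (fun i => i \notin S)) => [|i j iS jS]; last first.
  by rewrite /x (negPf iS) (negPf jS).
rewrite (cross (fun i => i \in S) (fun i => i \notin S)) => [|i j iS jS]; last first.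
  by rewrite /x iS (negPf jS).
rewrite (cross (fun i => i \notin S) (fun i => i \in S)) => [|i j iS jS]; last first.
  by rewrite /x jS (negPf iS) -sqrrN opprB.
rewrite -(flow_cut_sym S ok) -/c; field.
by rewrite !gt_eqF.
Qed.

Lemma lambda_dv_le_psi_set : lambda_dv E pi <= 2 * psi_set E pi S.
Proof.
apply: le_trans (lambda_dv_le cut_vector_feasible) _.
apply: ge_sup.
  by exists (flow_energy E (fun _ _ => 0) cut_vector), (fun _ _ => 0) => //; exact: zero_flow_ok.
move=> _ [F ok <-]; rewrite cut_vector_energy// /psi_set -/p -/q.
set c := \sum_(i in S) _; set bd := Num.min (wt _ _) _.
have c_le : c <= bd.
  rewrite le_min (flow_cut S ok)/= /c flow_cut_sym//.
  apply: le_trans (flow_cut (~: S)%SET ok); rewrite le_eqVlt; apply/orP; left; apply/eqP.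
  by apply: eq_big => i; rewrite ?inE// => _; apply: eq_bigl => j; rewrite !inE negbK.
have min0 : 0 < Num.min p q by rewrite lt_min p0.
have c0 : 0 <= c.
  case: ok => F0 _; apply: sumr_ge0 => i _; apply: sumr_ge0 => j /andP[Eij _]; exact: F0.
(* [P] is at most twice the larger of [p] and [q]. *)
have ratio : P / (p * q) <= 2 / Num.min p q.
  rewrite ler_pdivrMr ?mulr_gt0// mulrAC ler_pdivlMr// -pqP.
  by have := p0; have := q0; case: (leP p q) => h; nra.
apply: (@le_trans _ _ (2 / Num.min p q * c)); first by rewrite ler_wpM2r.
have -> : 2 * (bd / Num.min p q) = 2 / Num.min p q * bd by ring.
by rewrite ler_wpM2l// divr_ge0// ltW.
Qed.

End CutVector.

(** Row vectors become sequences, extended by 0, to fit the recursion of [dot] on sign lists. *)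
Definition coords (v : 'I_n -> 'rV[R]_n) (i : 'I_n) (k : nat) : R :=
  if insub k is Some l then v i ord0 l else 0.

Lemma coordsE v i (k : 'I_n) : coords v i k = v i ord0 k.
Proof. by rewrite /coords valK. Qed.

Lemma psi_graph_le_energy (c : R) (v : 'I_n -> 'rV[R]_n) : 0 < c -> (1 < n)%N ->
  (forall (u : 'I_n -> nat -> R) (w : 'I_n -> R),
    (forall i, 0 <= w i) -> \sum_i w i = 1 ->
    (forall i j k, sqdist n u i k <= sqdist n u i j + sqdist n u j k) ->
    (forall k, \sum_i w i * u i k = 0) -> \sum_i w i * nrm n (u i) = 1 ->
    exists A h, spread n u A h /\ c <= spread_mass w A h) ->
  feasible pi v -> psi_graph E pi * c <= 8 * max_flow_energy E pi v.
Proof.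
move=> c0 n1 structure [cent [norm1 tri]].
have P0 : 0 < P.
  by rewrite (bigD1 (Ordinal (ltnW n1)))//= ltr_wpDr// sumr_ge0.
(* [pi] becomes a probability weight, and scaling by the square root of [P] keeps the second moment
   1. Later [h] is divided by [P] to undo the scaling. *)
pose w i := pi i / P; pose u i k := Num.sqrt P * coords v i k.
have sP : Num.sqrt P ^+ 2 = P by rewrite sqr_sqrtr// ltW.
have distE i j : sqdist n u i j = P * sqnorm (v i - v j).
  rewrite /sqdist /nrm /sqnorm mulr_sumr; apply: eq_bigr => k _.
  by rewrite /u -mulrBr exprMn sP !coordsE !mxE.
have nrmE i : nrm n (u i) = P * sqnorm (v i).
  rewrite /nrm /sqnorm mulr_sumr; apply: eq_bigr => k _.
  by rewrite /u exprMn sP coordsE.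
have [|||||A [h [[h0 hA] mass]]] := structure u w.
- by move=> i; rewrite divr_ge0// ltW.
- by rewrite -mulr_suml divff// gt_eqF.
- by move=> i j k; rewrite !distE -mulrDr ler_pM2l.
- move=> k; transitivity (Num.sqrt P / P * \sum_i pi i * coords v i k).
    by rewrite mulr_sumr; apply: eq_bigr => i _; rewrite /w /u; ring.
  rewrite /coords; case: insubP => [l _ _|_]; last by rewrite [X in _ * X]big1 ?mulr0// => i _; rewrite mulr0.
  suff -> : \sum_i pi i * v i ord0 l = 0 by rewrite mulr0.
  have := congr1 (fun M : 'rV[R]_n => M ord0 l) cent; rewrite summxE mxE => cl.
  by rewrite -[RHS]cl; apply: eq_bigr => i _; rewrite mxE.
- rewrite -norm1; apply: eq_bigr => i _; by rewrite nrmE /w mulrA divfK// gt_eqF.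
have flowD F : flow_ok E pi F ->
    \sum_i \sum_(j | E i j) F i j * (sqnorm (v i - v j) / 2) <= max_flow_energy E pi v.
  move=> ok; apply: le_trans (flow_energy_le v ok); rewrite /flow_energy mulr_sumr.
  apply: ler_sum => i _; rewrite mulr_sumr; apply: ler_sum => j _.
  by rewrite mulrA mulrC.
have [q [r [q0 dual valD]]] := @flow_duality (fun i j => sqnorm (v i - v j)) _ flowD.
have distC i j : sqnorm (v i - v j) = sqnorm (v j - v i).
  by apply: eq_bigr => k _; rewrite !mxE -sqrrN opprB.
have distxx i : sqnorm (v i - v i) = 0.
  by rewrite subrr /sqnorm big1// => k _; rewrite mxE expr0n.
have h'0 j : 0 <= h j / P by rewrite divr_ge0// ltW.
have h'A i j : i \in A -> h j / P <= sqnorm (v i - v j).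
  by move=> iA; rewrite ler_pdivrMr// mulrC -distE hA.
have main := rounding pi0 distxx distC tri q0 dual h'0 h'A.
have massE : (\sum_(i in A) pi i) * (\sum_j pi j * (h j / P)) = P * spread_mass w A h.
  rewrite /spread_mass /w -mulr_suml.
  have -> : \sum_j pi j / P * h j = \sum_j pi j * (h j / P) by apply: eq_bigr => j _; ring.
  by field; rewrite gt_eqF.
rewrite massE in main; rewrite -(ler_pM2l P0).
have psi0 := psi_graph_ge0 E pi0.
have h1 : psi_graph E pi * (P * c) <= psi_graph E pi * (P * spread_mass w A h).
  by rewrite ler_wpM2l// ler_pM2l.
rewrite mulrCA; apply: le_trans h1 _; apply: le_trans main _.
by rewrite mulrCA !ler_pM2l.
Qed.

End Flows.

Unset Implicit Arguments.

Theorem mainTheorem13 (R : realType) :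
  exists C : R, 0 < C /\
    forall (n : nat) (E : rel 'I_n) (pi : 'I_n -> R),
      (2 <= n)%N -> (forall i, 0 < pi i) ->
      lambda_dv E pi <= C * psi_graph E pi /\
      psi_graph E pi <= C * Num.sqrt (ln n%:R) * lambda_dv E pi.
Proof.
have [c c0 arv] := arv_spread R.
(* The 2 serves the cut embeddings; [8 / c] combines the rounding loss with the structure
   theorem. *)
exists (2 + 8 / c); split; first by rewrite addr_gt0// divr_gt0.
move=> n E pi n2 pi0.
have C0 : 0 < 2 + 8 / c by rewrite addr_gt0// divr_gt0.
pose k0 : 'I_n := Ordinal (ltnW n2); pose k1 : 'I_n := Ordinal n2.
have S0 : [set k0]%SET != finset.set0 by apply/set0Pn; exists k0; rewrite inE.
have ST : [set k0]%SET != [set: 'I_n]%SET.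
  by apply/eqP => /setP/(_ k1); rewrite !inE.
have psi0 := psi_graph_ge0 E pi0.
split.
  apply: (@le_trans _ _ (2 * psi_graph E pi)); last first.
    by rewrite ler_wpM2r// lerDl divr_ge0// ltW.
  rewrite mulrC -ler_pdivrMr//; apply: lb_le_inf.
    by exists (psi_set E pi [set k0]%SET), [set k0]%SET => //=; rewrite S0 ST.
  move=> _ [S /andP[Sn0 SnT] <-]; rewrite ler_pdivrMr// mulrC.
  exact: lambda_dv_le_psi_set.
set L := Num.sqrt _.
have L0 : 0 < L by rewrite sqrtr_gt0 ln_gt0// ltr1n.
have CL : 0 < (2 + 8 / c) * L by rewrite mulr_gt0.
rewrite mulrC -ler_pdivrMr//; apply: lb_le_inf.
  (* [lb_le_inf] needs a nonempty set, so a feasible embedding is exhibited. *)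
  exists (max_flow_energy E pi (cut_vector pi k0 [set k0]%SET)), (cut_vector pi k0 [set k0]%SET) => //.
  exact: cut_vector_feasible.
move=> _ [v fv <-]; rewrite ler_pdivrMr//.
have cL : 0 < c / L by rewrite divr_gt0.
have : psi_graph E pi * (c / L) <= 8 * max_flow_energy E pi v.
  apply: psi_graph_le_energy => // u w w0 w1 tri cent norm1.
  by have := arv 'I_n n u w; rewrite card_ord => /(_ n2 w0 w1 tri cent norm1).
rewrite mulrA ler_pdivrMr// -(ler_pdivlMr)// => h; apply: le_trans h _.
have e0 := max_flow_energy_ge0 E pi0 v.
have -> : 8 * max_flow_energy E pi v * L / c = max_flow_energy E pi v * (8 / c * L).
  by field; rewrite gt_eqF.
by rewrite ler_wpM2l// ler_pM2r// lerDr.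
Qed.
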